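(* Let $(\Omega,\mathfrak{F},\mathbb{P})$ be a complete probability space, let $X\in L^2[\Omega;\mathbb{F}]$, and let $\widetilde X=X\oplus\mathbb{I}_{-\mathbf{Ste}(X)}$. Then $X$ is a translation if and only if $H_{\widetilde X}^{\bot}$ satisfies $$\mathbb{E}X=H_{\widetilde X}^{\bot}\oplus\mathbb{I}_{\mathbb{E}(\mathbf{Ste}(X))},$$ where $\mathbb{E}X$ is the Aumann expectation of $X$.
   Context: Fix $d\ge 1$. $\mathbb{F}$ denotes the set of all functions $\nu:\mathbb{R}^d\to[0,1]$ such that: (1) $\nu$ is upper semicontinuous, i.e. for each $\alpha\in(0,1]$ the level set $\nu_\alpha=\{x:\nu(x)\ge\alpha\}$ is closed; (2) $\nu_1\ne\emptyset$; (3) $\nu_0:=\overline{\{x:\nu(x)>0\}}$ is compact; (4) $\nu_\alpha$ is convex for every $\alpha\in[0,1]$. Thus all $\nu_\alpha$, $\alpha\in[0,1]$, are non-empty compact convex sets. Addition on $\mathbb{F}$: $(\nu^1\oplus\nu^2)_\alpha=\nu^1_\alpha+\nu^2_\alpha$ (Minkowski sum). For $a\in\mathbb{R}^d$, $\mathbb{I}_a\in\mathbb{F}$ is the indicator function of $\{a\}$. $S^{d-1}$ is the unit sphere of $\mathbb{R}^d$. For a non-empty compact convex $A\subset\mathbb{R}^d$, $s_A(x)=\sup\{\langle x,a\rangle:a\in A\}$, $x\in S^{d-1}$. For $\nu\in\mathbb{F}$, $s_\nu(x,\alpha)=s_{\nu_\alpha}(x)$ for $(x,\alpha)\in S^{d-1}\times[0,1]$.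 Metric: $d_2(\nu^1,\nu^2)=\big(\int_0^1\int_{S^{d-1}}|s_{\nu^1}(u,\alpha)-s_{\nu^2}(u,\alpha)|^2\,du\,d\alpha\big)^{1/2}$, with $du$ the normalized Lebesgue measure on $S^{d-1}$. The Steiner point of $A$ is $\mathbf{ste}(A)=\frac1{v_d}\int_{S^{d-1}}s_A(x)\,x\,d\lambda(x)$, where $\lambda$ is the Lebesgue (surface) measure on $S^{d-1}$ and $v_d$ the volume of the unit ball. The generalized Steiner point of $\nu\in\mathbb{F}$ is $\mathbf{Ste}(\nu)=\int_0^1\mathbf{ste}(\nu_\alpha)\,d\alpha$; for a random $X$, $\mathbf{Ste}(X)$ is the random vector $\omega\mapsto\mathbf{Ste}(X(\omega))$. A fuzzy set-valued random variable (FRV) is a map $X:\Omega\to\mathbb{F}$ such that for every $\alpha\in(0,1]$ the map $\omega\mapsto X(\omega)_\alpha$ is measurable with respect to the Borel $\sigma$-algebra generated by the Hausdorff metric on the space of non-empty compact convex subsets of $\mathbb{R}^d$. $L^2[\Omega;\mathbb{F}]$ is the set of FRVs $X$ with $\mathbb{E}[(\sup_{x\in X_0}\|x\|)^2]<\infty$. The Aumann expectation $\mathbb{E}X$ is the element of $\mathbb{F}$ with $(\mathbb{E}X)_\alpha=\{\mathbb{E}f: f\in L^1[\Omega;\mathbb{R}^d],\ f\in X_\alpha\ \mathbb{P}\text{-a.e.}\}$ for every $\alpha\in[0,1]$. An FRV $X$ is a translation if there exists (a deterministic) $M\in\mathbb{F}$ with $\mathbf{Ste}(M)=0$ such that $X(\omega)=M\oplus\mathbb{I}_{\mathbf{Ste}(X(\omega))}$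 for $\mathbb{P}$-almost every $\omega$. For $K\in\mathbb{F}$ with $\mathbf{Ste}(K)=0$, $\theta_K=\{B\in\mathbb{F}:\mathbf{Ste}(B)=0\text{ and there exists }A\in\mathbb{F}\text{ with }B\oplus A=K\}$. For an FRV $Z$ with $\mathbf{Ste}(Z)=0$, $\Theta_Z=\{B\in\mathbb{F}:\mathbb{P}(\{\omega:B\in\theta_{Z(\omega)}\})=1\}$. For $Z\in L^2[\Omega;\mathbb{F}]$ with $\mathbf{Ste}(Z)=0$, $H_Z^{\bot}$ denotes the unique minimizer of $B\mapsto\mathbb{E}[d_2(Z,B)^2]$ over $B\in\Theta_Z$. *)

(* Defs.v *)
From HB Require Import structures.
From mathcomp Require Import all_boot all_order all_algebra.
From mathcomp Require Import all_classical all_reals all_analysis.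
From mathcomp Require Import measurable_realfun.

Set Implicit Arguments.
Unset Strict Implicit.
Unset Printing Implicit Defensive.

Import Order.TTheory GRing.Theory Num.Theory.
Import numFieldNormedType.Exports.

Local Open Scope classical_set_scope.
Local Open Scope ring_scope.

Section euclid.
Context {R : realType} {d : nat}.
Implicit Types (x y : 'rV[R]_d) (A B : set 'rV[R]_d).

Definition dot x y : R := \sum_(i < d) x 0 i * y 0 i.

(* The canonical norm on ['rV[R]_d] is the sup norm; its topology is the same. *)
Definition enorm x : R := Num.sqrt (dot x x).

Definition sphere : set 'rV[R]_d := [set x | enorm x = 1].

Definition mink A B : set 'rV[R]_d := [set a + b | a in A & b in B].

Definition support_fun A x : R := sup [set dot x a | a in A].

Definition convex_body : set (set 'rV[R]_d) :=
  [set A : set 'rV[R]_d | [/\ A !=set0, compact A & convex_set A]].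

Definition hausdorff_dist A B : R :=
  Num.max (sup [set inf [set enorm (a - b) | b in B] | a in A])
          (sup [set inf [set enorm (a - b) | a in A] | b in B]).

(* Open sets of the space of convex bodies for the Hausdorff metric. *)
Definition hausdorff_open : set (set (set 'rV[R]_d)) :=
  [set U | U `<=` convex_body /\
    forall A, U A -> exists2 e : R, 0 < e &
      forall B, convex_body B -> hausdorff_dist A B < e -> U B].

End euclid.

Section rV_measurable.
Context {R : realType}.

(* Row vectors carry the sigma-algebra generated by the coordinates. *)
Definition rV_display : measure_display. Proof. exact. Qed.

Let coord n (i : 'I_n) (x : 'rV[R]_n) : R := x 0 i.

Let rV_set0 n : g_sigma_preimage (@coord n) set0.
Proof. exact: sigma_algebra0. Qed.

Let rV_setC n A : g_sigma_preimage (@coord n) A ->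
  g_sigma_preimage (@coord n) (~` A).
Proof. exact: sigma_algebraC. Qed.

Let rV_bigcup n (F : _^nat) : (forall i, g_sigma_preimage (@coord n) (F i)) ->
  g_sigma_preimage (@coord n) (\bigcup_i (F i)).
Proof. exact: sigma_algebra_bigcup. Qed.

HB.instance Definition _ n := @isMeasurable.Build rV_display
  'rV[R]_n (g_sigma_preimage (@coord n)) (@rV_set0 n) (@rV_setC n)
  (@rV_bigcup n).

Lemma measurable_coord n (i : 'I_n) :
  measurable_fun setT (fun x : 'rV[R]_n => x 0 i).
Proof.
move=> _ Y mY; rewrite setTI; apply: sub_sigma_algebra => /=.
rewrite -bigcup_seq/=; exists i => /=; first by rewrite mem_index_enum.
by exists Y => //; rewrite setTI.
Qed.

Lemma measurable_rowP d (T : measurableType d) n (f : T -> 'rV[R]_n) :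
  measurable_fun setT f <-> forall i, measurable_fun setT (fun x => f x 0 i).
Proof.
split=> [mf i|mf].
  exact: (measurableT_comp (measurable_coord i) mf).
suff : g_sigma_preimage (fun i => coord i \o f) `<=` measurable.
  rewrite g_sigma_preimage_comp => prefS _ A mA.
  by apply: prefS; exists A.
apply: smallest_sub; first exact: sigma_algebra_measurable.
case: n => [|n] in f mf *; first by rewrite big_ord0.
rewrite -bigcup_mkord_ord; apply: bigcup_sub => i Ii.
by move=> A [B mB <-]; exact: mf.
Qed.

Lemma measurable_enorm n : measurable_fun setT (@enorm R n).
Proof.
have h : continuous (@Num.sqrt R) by exact: sqrt_continuous.
apply: (measurableT_comp (continuous_measurable_fun h)).
apply: measurable_sum => i.
by apply: measurable_funM; exact: measurable_coord.
Qed.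

End rV_measurable.

Section lebesgue_rV.
Context {R : realType}.

Definition rV_cons n (p : R * 'rV[R]_n) : 'rV[R]_n.+1 :=
  \row_i if unlift ord0 i is Some j then p.2 0 j else p.1.

Definition rV_behead n (x : 'rV[R]_n.+1) : 'rV[R]_n :=
  \row_i x 0 (lift ord0 i).

Lemma rV_cons0 n (p : R * 'rV[R]_n) : rV_cons p 0 0 = p.1.
Proof. by rewrite mxE unlift_none. Qed.

Lemma rV_consS n (p : R * 'rV[R]_n) i : rV_cons p 0 (lift ord0 i) = p.2 0 i.
Proof. by rewrite mxE liftK. Qed.

Lemma rV_consK n (p : R * 'rV[R]_n) :
  (rV_cons p 0 0, rV_behead (rV_cons p)) = p.
Proof.
by rewrite rV_cons0 [RHS]surjective_pairing; congr pair; apply/rowP => i;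
  rewrite mxE rV_consS.
Qed.

Lemma rV_cons_eta n (x : 'rV[R]_n.+1) : rV_cons (x 0 0, rV_behead x) = x.
Proof.
apply/rowP => i; case: (unliftP ord0 i) => [j|] ->; last exact: rV_cons0.
by rewrite rV_consS mxE.
Qed.

Lemma measurable_rV_cons n : measurable_fun setT (@rV_cons n).
Proof.
apply/measurable_rowP => i; case: (unliftP ord0 i) => [j|] ->.
  rewrite (_ : (fun _ => _) = (fun x : 'rV_n => x 0 j) \o snd).
    exact: (measurableT_comp (measurable_coord j) measurable_snd).
  by apply/funext => p; rewrite /= rV_consS.
rewrite (_ : (fun _ => _) = fst); first exact: measurable_fst.
by apply/funext => p; rewrite rV_cons0.
Qed.

Lemma measurable_rV_behead n : measurable_fun setT (@rV_behead n).
Proof.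
apply/measurable_rowP => i; rewrite (_ : (fun _ => _) =
  (fun x : 'rV[R]_n.+1 => x 0 (lift ord0 i))); first exact: measurable_coord.
by apply/funext => p; rewrite mxE.
Qed.

Section step.
Context n (mu : {sigma_finite_measure set 'rV[R]_n -> \bar R}).

Definition lebesgue_step : set 'rV[R]_n.+1 -> \bar R :=
  pushforward (lebesgue_measure \x mu)%E (@rV_cons n).

Let step_measure : {measure set 'rV[R]_n.+1 -> \bar R} :=
  measure_function_pushforward__canonical__measure_function_Measure
    (lebesgue_measure \x mu)%E (@measurable_rV_cons n).

Let lebesgue_step0 : lebesgue_step set0 = 0%E.
Proof. exact: (measure0 step_measure). Qed.

Let lebesgue_step_ge0 A : (0 <= lebesgue_step A)%E.
Proof. exact: (measure_ge0 step_measure). Qed.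

Let lebesgue_step_sigma_additive : semi_sigma_additive lebesgue_step.
Proof. exact: (@measure_semi_sigma_additive _ _ _ step_measure). Qed.

HB.instance Definition _ := isMeasure.Build _ _ _ lebesgue_step
  lebesgue_step0 lebesgue_step_ge0 lebesgue_step_sigma_additive.

Lemma lebesgue_step_sigma_finite : sigma_finite setT lebesgue_step.
Proof.
have /sigma_finiteP[F [FT ndF Foo]] :=
  sigma_finiteT (@lebesgue_measure R).
have /sigma_finiteP[G [GT ndG Goo]] := sigma_finiteT mu.
pose h (x : 'rV[R]_n.+1) := (x 0 0, rV_behead x).
have mh : measurable_fun setT h.
  by apply/measurable_fun_pairP; split;
    [exact: measurable_coord|exact: measurable_rV_behead].
exists (fun k => h @^-1` (F k `*` G k)).
  apply/seteqP; split => // x _.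
  have [k _ Fk] : (\bigcup_k F k) (x 0 0) by rewrite -FT.
  have [l _ Gl] : (\bigcup_k G k) (rV_behead x) by rewrite -GT.
  exists (maxn k l) => //; split => /=.
  - by move: Fk; exact/subsetPset/ndF/leq_maxl.
  - by move: Gl; exact/subsetPset/ndG/leq_maxr.
move=> k; have [mF Fk] := Foo k; have [mG Gk] := Goo k; split.
  by rewrite -[X in measurable X]setTI; apply: mh => //; exact: measurableX.
rewrite /lebesgue_step /pushforward -comp_preimage (_ : h \o _ = id).
  by rewrite preimage_id product_measure1E// lte_mul_pinfty// ge0_fin_numE.
by apply/funext => p /=; rewrite /h rV_consK.
Qed.

HB.instance Definition _ := Measure_isSigmaFinite.Build _ _ _
  lebesgue_step lebesgue_step_sigma_finite.

End step.

(* [n]-dimensional Lebesgue measure, as an iterated product measure. *)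
Fixpoint lebesgue_rV n : {sigma_finite_measure set 'rV[R]_n -> \bar R} :=
  match n with
  | 0 => \d_(0 : 'rV[R]_0)
  | n'.+1 => lebesgue_step (lebesgue_rV n')
  end.

End lebesgue_rV.

Section surface.
Context {R : realType} {d : nat}.

Definition ball1 : set 'rV[R]_d := [set x | enorm x <= 1].

Definition direction (x : 'rV[R]_d) : 'rV[R]_d := (enorm x)^-1 *: x.

Lemma measurable_direction : measurable_fun setT direction.
Proof.
apply/measurable_rowP => i; rewrite (_ : (fun _ => _) =
    (fun x : 'rV[R]_d => (enorm x `^ (-1)) * x 0 i)); last first.
  by apply/funext => x; rewrite mxE powR_inv1// sqrtr_ge0.
apply: measurable_funM; last exact: measurable_coord.
exact: (@measurableT_comp _ _ _ _ _ _ (@powR R ^~ (-1)) _ _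
  (measurable_powR _) (@measurable_enorm R d)).
Qed.

Definition punctured_ball1 : set 'rV[R]_d := [set x | 0 < enorm x <= 1].

Lemma measurable_punctured_ball1 : measurable punctured_ball1.
Proof.
rewrite (_ : punctured_ball1 = setT `&` (@enorm R d) @^-1` `]0, 1]%classic).
  exact: measurable_enorm.
by rewrite setTI; apply/seteqP; split => x /=; rewrite in_itv.
Qed.

(* Surface measure of the sphere as cone measure: [d] times the volume of the
   cone over [A]. For [d = 1] it is the counting measure on {-1, 1}. *)
Definition surface (A : set 'rV[R]_d) : \bar R :=
  (d%:R%:E * lebesgue_rV d (direction @^-1` A `&` punctured_ball1))%E.

Let surface_measure : {measure set 'rV[R]_d -> \bar R} :=
  mscale d%:R%:nng
    (measure_function_pushforward__canonical__measure_function_Measure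
      (mrestr (lebesgue_rV d) measurable_punctured_ball1)
      measurable_direction).

Let surface0 : surface set0 = 0%E.
Proof. exact: (measure0 surface_measure). Qed.

Let surface_ge0 A : (0 <= surface A)%E.
Proof. exact: (measure_ge0 surface_measure). Qed.

Let surface_sigma_additive : semi_sigma_additive surface.
Proof. exact: (@measure_semi_sigma_additive _ _ _ surface_measure). Qed.

HB.instance Definition _ := isMeasure.Build _ _ _ surface
  surface0 surface_ge0 surface_sigma_additive.

End surface.

Section fuzzy.
Context {R : realType} {d : nat}.
Implicit Types (x y : 'rV[R]_d) (A B : set 'rV[R]_d).

Definition level (nu : 'rV[R]_d -> R) (a : R) : set 'rV[R]_d :=
  if a == 0 then closure [set x | 0 < nu x] else [set x | a <= nu x].

Record is_fuzzy (nu : 'rV[R]_d -> R) : Prop := IsFuzzy {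
  fuzzy01 : forall x, 0 <= nu x <= 1 ;
  fuzzy_usc : forall a, 0 < a <= 1 -> closed (level nu a) ;
  fuzzy_normal : level nu 1 !=set0 ;
  fuzzy_compact : compact (level nu 0) ;
  fuzzy_convex : forall a, 0 <= a <= 1 -> convex_set (level nu a) }.

End fuzzy.

Record fuzzy (R : realType) (d : nat) := Fuzzy {
  membership :> 'rV[R]_d -> R ;
  membershipP : is_fuzzy membership }.

Lemma fuzzy_ext (R : realType) (d : nat) (nu mu : fuzzy R d) :
  (forall x, nu x = mu x) -> nu = mu.
Proof.
case: nu mu => [f fP] [g gP] /= fg; have {}fg : f = g by exact/funext.
by subst g; congr Fuzzy; exact: Prop_irrelevance.
Qed.

Section fuzzy_theory.
Context {R : realType} {d : nat}.
Implicit Types (x y : 'rV[R]_d) (A B : set 'rV[R]_d) (nu mu : fuzzy R d).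

Lemma level0E (f : 'rV[R]_d -> R) : level f 0 = closure [set x | 0 < f x].
Proof. by rewrite /level eqxx. Qed.

Lemma level_pos (f : 'rV[R]_d -> R) a : 0 < a ->
  level f a = [set x | a <= f x].
Proof. by move=> a0; rewrite /level gt_eqF. Qed.

Lemma level_anti (f : 'rV[R]_d -> R) a b : 0 <= a -> a <= b ->
  level f b `<=` level f a.
Proof.
rewrite le_eqVlt => /predU1P[<-|a0] ab; last first.
  by rewrite !level_pos// ?(lt_le_trans a0)// => x /=; exact: le_trans.
move: ab; rewrite le_eqVlt => /predU1P[<-//|b0].
rewrite level0E level_pos// => x /= bx; apply: subset_closure => /=.
exact: lt_le_trans bx.
Qed.

Lemma rV_hausdorff : hausdorff_space 'rV[R]_d.
Proof. exact: norm_hausdorff. Qed.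

Lemma closed_level nu a : 0 <= a <= 1 -> closed (level nu a).
Proof.
move=> /andP[]; rewrite le_eqVlt => /predU1P[<- _|a0 a1].
  by rewrite level0E; exact: closed_closure.
by apply: (fuzzy_usc (membershipP nu)); rewrite a0.
Qed.

Lemma compact_level nu a : 0 <= a <= 1 -> compact (level nu a).
Proof.
move=> a01; apply: (subclosed_compact _ (fuzzy_compact (membershipP nu))).
  exact: closed_level.
by case/andP: a01 => a0 _; exact: level_anti.
Qed.

Lemma level_neq0 nu a : 0 <= a <= 1 -> level nu a !=set0.
Proof.
case/andP => a0 a1; have [x nux] := fuzzy_normal (membershipP nu).
by exists x; exact: level_anti nux.
Qed.

Lemma convex_level nu a x y (t : {i01 R}) : 0 <= a <= 1 ->
  level nu a x -> level nu a y -> level nu a (t%:num *: x + (1 - t%:num) *: y).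
Proof.
move=> a01 nx ny.
have := fuzzy_convex (membershipP nu) a01 t (mem_set nx) (mem_set ny).
by rewrite inE.
Qed.

Lemma mink_compact A B : compact A -> compact B -> compact (mink A B).
Proof.
move=> cA cB; rewrite (_ : mink A B = (fun p => p.1 + p.2) @` (A `*` B)).
  apply: continuous_compact; last exact: compact_setX.
  by apply: continuous_subspaceT => p; exact: add_continuous.
apply/seteqP; split => [_ [a Aa [b Bb <-]]|_ [[a b] [/= Aa Bb] <-]].
  by exists (a, b).
by exists a => //; exists b.
Qed.

(* The function whose level sets are the Minkowski sums of those of [nu] and
   [mu], see [level_fadd] below. *)
Definition fadd_fun nu mu x : R :=
  sup [set a : R | 0 <= a <= 1 /\ mink (level nu a) (level mu a) x].

Section fadd.
Variables nu mu : fuzzy R d.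
Let S a := mink (level nu a) (level mu a).

Let S_anti a b : 0 <= a -> a <= b -> S b `<=` S a.
Proof.
move=> a0 ab _ [x nx [y my <-]]; exists x; first exact: level_anti nx.
by exists y => //; exact: level_anti my.
Qed.

Let S_compact a : 0 <= a <= 1 -> compact (S a).
Proof. by move=> a01; apply: mink_compact; exact: compact_level. Qed.

Let S_left a x : 0 < a <= 1 -> (forall b, 0 < b < a -> S b x) -> S a x.
Proof.
move=> /andP[a0 a1] Sx.
pose K b := [set y | level nu b y /\ level mu b (x - y)].
have Kanti b c : 0 <= b -> b <= c -> K c `<=` K b.
  by move=> b0 bc y [h1 h2]; split; [exact: level_anti h1|exact: level_anti h2].
have b01 b : 0 < b < a -> 0 <= b <= 1.
  by move=> /andP[b0 /ltW ba]; rewrite ltW//= (le_trans ba).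
have clK b : 0 < b < a -> closed (K b).
  move=> ba; apply: closedI; first exact: closed_level (b01 _ ba).
  apply: (@preimage_closed _ _ (fun y => x - y) (level mu b)).
    by move=> y _; apply: continuousB; [exact: cst_continuous|exact: cvg_id].
  exact: closed_level (b01 _ ba).
pose F := filter_from [set b | 0 < b < a] K.
have FF : ProperFilter F.
  apply: filter_from_proper.
    apply: filter_from_filter.
      by exists (a / 2) => /=; rewrite divr_gt0//= ltr_pdivrMr// ltr_pMr// ltr1n.
    move=> b c /= ba ca; exists (Num.max b c) => /=.
      by case: (leP b c).
    by move=> y Ky; split; apply: Kanti Ky;
      rewrite ?le_max ?lexx ?orbT// ltW//; [case/andP: ba|case/andP: ca].
  by move=> b /Sx [y ny [z mz yz]]; exists y; split => //; rewrite -yz addrC addKr.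
have ha : 0 < a / 2 < a.
  by rewrite divr_gt0//= ltr_pdivrMr// ltr_pMr// ltr1n.
have [|y [ny cly]] := @compact_level nu _ (b01 _ ha) _ FF.
  by exists (a / 2) => // y [].
have Ky b : 0 < b < a -> K b y.
  move=> ba; apply: (clK _ ba) => U Uy.
  by have [z [Kz Uz]] := cly (K b) U (ex_intro2 _ _ b ba (fun _ => id)) Uy;
    exists z.
have key (r : R) : (forall b, 0 < b < a -> b <= r) -> a <= r.
  move=> h; rewrite leNgt; apply/negP => ra.
  have := h (Num.max ((r + a) / 2) (a / 2)).
  have ra2 : (r + a) / 2 < a by rewrite ltr_pdivrMr// mulr_natr mulr2n ltrD2r.
  case/andP: ha => ha0 ha1.
  rewrite lt_max ha0 orbT /= gt_max ra2 ha1 => /(_ isT).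
  rewrite ge_max => /andP[+ _]; rewrite leNgt => /negP; apply.
  by rewrite ltr_pdivlMr// mulr_natr mulr2n ltrD2l.
exists y; [|exists (x - y); last by rewrite addrC subrK].
  rewrite level_pos//=; apply: key => b ba; have [+ _] := Ky _ ba.
  by rewrite level_pos//; case/andP: ba.
rewrite level_pos//=; apply: key => b ba; have [_] := Ky _ ba.
by rewrite level_pos//; case/andP: ba.
Qed.

Let S0E : S 0 = closure [set x | exists2 a, 0 < a <= 1 & S a x].
Proof.
apply/seteqP; split => [_ [y + [z + <-]]|].
  rewrite !level0E => cy cz U.
  move=> /(@add_continuous 'rV[R]_d (y, z))[[P Q] /= [Py Qz] PQU].
  have [y' [/= ny Py']] := cy _ Py; have [z' [/= mz Qz']] := cz _ Qz.
  exists (y' + z'); split; last exact: (PQU (y', z')).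
  have /andP[_ n1] := fuzzy01 (membershipP nu) y'.
  exists (Num.min (nu y') (mu z')); first by rewrite lt_min ny mz ge_min n1.
  by exists y'; [|exists z' => //];
    rewrite level_pos ?lt_min ?ny//= ge_min lexx ?orbT.
have /closure_id -> : closed (S 0).
  by apply: compact_closed; [exact: rV_hausdorff|apply: S_compact; rewrite lexx ler01].
apply: closureS => x [a /andP[a0 _]]; apply: S_anti => //; exact: ltW.
Qed.

Let ubS x : has_ubound [set a : R | 0 <= a <= 1 /\ S a x].
Proof. by exists 1 => a [/andP[]]. Qed.

Let fadd_posP x (r : R) : 0 <= r -> r < fadd_fun nu mu x ->
  exists2 a, r < a <= 1 & S a x.
Proof.
move=> r0 rx; have hs : has_sup [set a : R | 0 <= a <= 1 /\ S a x].
  split => //; apply/set0P/eqP => E.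
  by move: rx; rewrite /fadd_fun -/S E sup0 ltNge r0.
have [a [/andP[_ a1] Sa] ra] := sup_gt hs.1 rx.
by exists a => //; rewrite ra.
Qed.

Lemma level_fadd_fun a : 0 <= a <= 1 -> level (fadd_fun nu mu) a = S a.
Proof.
case/andP; rewrite le_eqVlt => /predU1P[<- _|a0 a1].
  rewrite level0E S0E; congr closure; apply/seteqP; split => x /=.
    exact: fadd_posP.
  move=> [b /andP[b0 b1] Sb]; apply: (lt_le_trans b0).
  by apply: ub_le_sup; [exact: ubS|split; rewrite ?(ltW b0)].
rewrite level_pos//; apply/seteqP; split => x /=; last first.
  move=> Sa; apply: ub_le_sup; first exact: ubS.
  by split; rewrite ?(ltW a0).
move=> ax; apply: S_left; rewrite ?a0// => b /andP[b0 ba].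
have [c /andP[bc _] Sc] := fadd_posP (ltW b0) (lt_le_trans ba ax).
by apply: S_anti Sc; exact: ltW.
Qed.

Lemma fadd_is_fuzzy : is_fuzzy (fadd_fun nu mu).
Proof.
have I1 : 0 <= (1 : R) <= 1 by rewrite ler01 lexx.
have I0 : 0 <= (0 : R) <= 1 by rewrite ler01 lexx.
split.
- move=> x; apply/andP; split; rewrite /fadd_fun.
    have [[a Sa]|/nonemptyPn ->] := pselect
        ([set a : R | 0 <= a <= 1 /\ S a x] !=set0); last by rewrite sup0.
    by apply: (le_trans _ (ub_le_sup (@ubS x) Sa)); case: Sa => /andP[].
  have [Sa|/nonemptyPn ->] := pselect
    ([set a : R | 0 <= a <= 1 /\ S a x] !=set0); last by rewrite sup0.
  by apply: ge_sup => // a [/andP[]].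
- move=> a /andP[a0 a1]; have a01 : 0 <= a <= 1 by rewrite ltW.
  rewrite level_fadd_fun//; apply: compact_closed; first exact: rV_hausdorff.
  exact: S_compact.
- rewrite level_fadd_fun//; have [x nx] := @level_neq0 nu _ I1.
  have [y my] := @level_neq0 mu _ I1.
  by exists (x + y); exists x => //; exists y.
- by rewrite level_fadd_fun//; exact: S_compact.
- move=> a a01; rewrite level_fadd_fun// => x y t.
  rewrite !inE => -[x1 nx1 [x2 mx2 <-]] [y1 ny1 [y2 my2 <-]].
  exists (t%:num *: x1 + (1 - t%:num) *: y1); first exact: convex_level.
  exists (t%:num *: x2 + (1 - t%:num) *: y2); first exact: convex_level.
  by rewrite addrACA -!scalerDr.
Qed.

Definition fadd : fuzzy R d := Fuzzy fadd_is_fuzzy.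

Lemma level_fadd a : 0 <= a <= 1 ->
  level fadd a = mink (level nu a) (level mu a).
Proof. exact: level_fadd_fun. Qed.

End fadd.

Definition findic_fun (a x : 'rV[R]_d) : R := (x == a)%:R.

Lemma level_findic_fun a r : 0 <= r <= 1 -> level (findic_fun a) r = [set a].
Proof.
case/andP; rewrite le_eqVlt => /predU1P[<- _|r0 r1].
  rewrite level0E (_ : [set _ | _] = [set a]).
    apply/esym/closure_id; apply: accessible_closed_set1.
    exact/hausdorff_accessible/rV_hausdorff.
  apply/seteqP; split => x; rewrite /findic_fun /=.
    by case: eqP => // _; rewrite ltxx.
  by move=> ->; rewrite eqxx.
rewrite level_pos//; apply/seteqP; split => x; rewrite /findic_fun /=.
  by case: eqP => // _; rewrite leNgt r0.
by move=> ->; rewrite eqxx.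
Qed.

Lemma findic_is_fuzzy a : is_fuzzy (findic_fun a).
Proof.
split.
- by move=> x; rewrite /findic_fun; case: eqP => _; rewrite ?lexx ler01.
- move=> r /andP[r0 r1]; rewrite level_findic_fun ?(ltW r0)//.
  by apply: accessible_closed_set1; exact/hausdorff_accessible/rV_hausdorff.
- by rewrite level_findic_fun ?ler01 ?lexx//; exists a.
- by rewrite level_findic_fun ?ler01 ?lexx//; exact: compact_set1.
- move=> r r01; rewrite level_findic_fun// => x y t.
  rewrite !inE => -> ->; change (t%:num *: a + (1 - t%:num) *: a = a).
  by rewrite -scalerDl addrC subrK scale1r.
Qed.

Definition findic a : fuzzy R d := Fuzzy (findic_is_fuzzy a).

End fuzzy_theory.

Notation "nu '\oplus' mu" := (fadd nu mu) (at level 50, left associativity).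

Section steiner.
Context {R : realType} {d : nat}.
Implicit Types (A : set 'rV[R]_d) (nu mu B K : fuzzy R d).

Definition unit_ball_volume : R := fine (lebesgue_rV d (@ball1 R d)).

Definition steiner A : 'rV[R]_d :=
  \row_i (unit_ball_volume^-1 *
    \int[@surface R d]_(x in sphere) (support_fun A x * x 0 i)).

Definition fsteiner nu : 'rV[R]_d :=
  \row_i \int[lebesgue_measure]_(a in `[0, 1]) steiner (level nu a) 0 i.

Definition sphere_mean (f : 'rV[R]_d -> R) : R :=
  (fine (surface (@sphere R d)))^-1 * \int[surface]_(u in sphere) f u.

Definition d2 nu mu : R :=
  Num.sqrt (\int[lebesgue_measure]_(a in `[0, 1])
    sphere_mean (fun u =>
      `|support_fun (level nu a) u - support_fun (level mu a) u| ^+ 2)).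

Definition theta K : set (fuzzy R d) :=
  [set B | fsteiner B = 0 /\ exists A : fuzzy R d, B \oplus A = K].

End steiner.

Section random_fuzzy.
Context {R : realType} {d : nat} {disp : measure_display}.
Context {Omega : measurableType disp} (P : probability Omega R).
Implicit Types (X Z : Omega -> fuzzy R d) (f : Omega -> 'rV[R]_d).

Definition frv X : Prop := forall a : R, 0 < a <= 1 ->
  forall U, <<s convex_body, hausdorff_open >> U ->
    measurable [set w | U (level (X w) a)].

Definition L2_frv X : Prop := frv X /\
  (\int[P]_w ((sup [set enorm x | x in level (X w) 0]) ^+ 2)%:E < +oo)%E.

Definition L1_vector f : Prop :=
  forall i, P.-integrable setT (fun w => (f w 0 i)%:E).

Definition expect f : 'rV[R]_d := \row_i fine 'E_P[fun w => f w 0 i].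

Definition aumann_expectation X (E : fuzzy R d) : Prop :=
  forall a : R, 0 <= a <= 1 ->
    level E a = [set expect f | f in
      [set f | L1_vector f /\ {ae P, forall w, level (X w) a (f w)}]].

Definition translation X : Prop := exists M : fuzzy R d,
  fsteiner M = 0 /\ {ae P, forall w, X w = M \oplus findic (fsteiner (X w))}.

Definition recenter X : Omega -> fuzzy R d :=
  fun w => X w \oplus findic (- fsteiner (X w)).

Definition Theta Z : set (fuzzy R d) :=
  [set B | {ae P, forall w, theta (Z w) B}].

Definition mean_square_d2 Z (B : fuzzy R d) : \bar R :=
  (\int[P]_w ((d2 (Z w) B) ^+ 2)%:E)%E.

Definition Hperp Z (H : fuzzy R d) : Prop :=
  Theta Z H /\
  forall B, Theta Z B -> (mean_square_d2 Z H <= mean_square_d2 Z B)%E.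

End random_fuzzy.

(* Main.v *)
Require Import Defs.
From mathcomp Require Import all_boot all_order all_algebra all_fingroup.
From mathcomp Require Import all_classical all_reals all_analysis.
From mathcomp Require Import measurable_realfun ring lra.

(** Write [X~] for the recentered variable, so that [X = X~ + Ste X], and recall
that the Steiner point moves along with translations. This rests on the identity
[int_S u_i u_j = v_d] if [i = j] and [0] otherwise ([sphere_second_moment]), which
comes from the invariance of Lebesgue measure under signed permutations of the
coordinates ([fsteiner_translate]).

Suppose that [X] is a translation of [M]. Then [X~ = M] almost surely, and [M] itself
is admissible in the minimization with cost [0]. The minimizer [H] is thus a summand of
[M] with [d2 M H = 0]. Writing [M = H + A], the distance is the [L2] norm of the support
function of [A], and its vanishing forces [A] to be the origin ([d2_summand_eq0]): a
nonzero point in one level of [A] keeps the support function large on a cap of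
the sphere and on all lower levels. So [H = M], and the Aumann expectation of
[M + Ste X] is [M + E (Ste X)] by Jensen's inequality for convex bodies
([expect_in_body], [aumann_of_translation]).

Conversely, let [EX] be a translate of [H]. Almost surely [X~ = H + A] for some [A] that
depends on the outcome. Consider the width [s(e_i) + s(- e_i)] along the axes, which is
additive and invariant under translation. Since [E s_X (u) <= s_EX (u)]
([support_aumann_ge]), the mean width of [X_al] is at most that of [EX_al], which
is the width of [H_al]; but the width of [X_al] is the one of [H_al] plus the one of
[A_al]. So almost surely all the widths of [A] vanish, [A] is a point, and [X] is a
translate of [H] ([translation_of_aumann]).

The inequality for [E s_X] requires measurable selections that almost maximize
[u . a] over [a] in [X_al]. The metric projections of the points [k u] do
this as [k] grows ([support_body_proj_gap]), and they are measurable because the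
projection onto a convex body is continuous for the Hausdorff metric
([body_proj_hausdorff]). *)

Set Implicit Arguments.
Unset Strict Implicit.
Unset Printing Implicit Defensive.

Import Order.TTheory GRing.Theory Num.Theory.
Import numFieldNormedType.Exports.

Local Open Scope classical_set_scope.
Local Open Scope ring_scope.

(** * Integrals and almost everywhere comparison *)

Section integrals.
Context disp (T : measurableType disp) (R : realType).
Variable mu : {measure set T -> \bar R}.

Lemma Rintegral_sum n (D : set T) (f : 'I_n -> T -> R) : measurable D ->
  (forall i, mu.-integrable D (EFin \o f i)) ->
  \int[mu]_(x in D) (\sum_(i < n) f i x) = \sum_(i < n) \int[mu]_(x in D) f i x.
Proof.
move=> mD intf; rewrite /Rintegral.
under eq_integral do rewrite -sumEFin.
rewrite integral_sum// -sum_fine// => i _.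
by apply: integrable_fin_num => //; exact: intf.
Qed.

Lemma integrable_sum_EFin n (D : set T) (f : 'I_n -> T -> R) : measurable D ->
  (forall i, mu.-integrable D (EFin \o f i)) ->
  mu.-integrable D (EFin \o (fun x => \sum_(i < n) f i x)).
Proof.
move=> mD intf.
rewrite (_ : EFin \o _ = (fun x => \sum_(i < n) (f i x)%:E)%E).
  by apply: integrable_sum => // i _; exact: intf.
by apply/funext => x /=; rewrite sumEFin.
Qed.

(** The integral of a nonnegative function is a supremum over the simple functions
below it, hence monotone even where measurability is unknown. This spares the
measurability in the level of the spherical means inside the distance [d2], and
that of the supremum of the norms on the support of a random fuzzy set. *)
Lemma ge0_le_integral_nomeas (D : set T) (f g : T -> \bar R) :
  (forall x, D x -> 0 <= f x)%E -> (forall x, D x -> f x <= g x)%E ->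
  (\int[mu]_(x in D) f x <= \int[mu]_(x in D) g x)%E.
Proof.
move=> f0 fg; rewrite !ge0_integralE//; last first.
  by move=> x Dx; exact: le_trans (f0 x Dx) (fg x Dx).
apply: ereal_sup_le => _ [h hf <-].
exists h => // x; apply: le_trans (hf x) _.
by rewrite /patch; case: ifP => // /set_mem/fg.
Qed.

(** From [2 |f| <= 1 + f ^ 2]. *)
Lemma integrable_sqr (D : set T) (f : T -> R) : (mu D < +oo)%E -> measurable D ->
  measurable_fun D f -> (\int[mu]_(x in D) ((f x) ^+ 2)%:E < +oo)%E ->
  mu.-integrable D (EFin \o f).
Proof.
move=> Doo mD mf foo.
have mf2 : measurable_fun D (EFin \o (fun x => (f x) ^+ 2)).
  by apply/measurable_EFinP; exact: measurable_funX.
apply: (@le_integrable _ _ _ _ _ mD _ (fun x => (1 + (f x) ^+ 2)%:E)).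
- exact/measurable_EFinP.
- move=> x Dx; rewrite /= lee_fin [leRHS]ger0_norm ?addr_ge0 ?sqr_ge0//.
  rewrite -(real_normK (num_real (f x))); have := sqr_ge0 (`|f x| - 1).
  by have := normr_ge0 (f x); nra.
- rewrite (_ : (fun x => _) = (cst 1%:E \+ (fun x => ((f x) ^+ 2)%:E)))%E.
    apply: integrableD => //; first apply: (@measurable_bounded_integrable _ _ _ _ (cst 1)) => //.
      by exists 1; split => // M M1 x _; rewrite /= normr1; exact: ltW.
    apply/integrableP; split => //.
    by under eq_integral do rewrite gee0_abs ?lee_fin ?sqr_ge0//.
  by apply/funext => x; rewrite /= EFinD.
Qed.

End integrals.

Section complete.
Context disp (T : measurableType disp) (R : realType).
Variable P : probability T R.
Hypothesis cP : measure_is_complete P.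

Lemma ae_eq_integral_complete (f g : T -> \bar R) : measurable_fun setT f ->
  {ae P, forall w, f w = g w} ->
  (\int[P]_w f w = \int[P]_w g w)%E.
Proof.
move=> mf fg; have fg' : ae_eq P setT f g by apply: filterS fg => w + _.
apply: ae_eq_integral => //.
exact: (ae_measurable_fun cP fg' mf).
Qed.

Lemma ae_eq_measurable (f g : T -> R) : measurable_fun setT f ->
  {ae P, forall w, f w = g w} -> measurable_fun setT g.
Proof.
move=> mf fg; apply/measurable_EFinP.
apply: (@ae_measurable_fun _ _ _ P cP _ (EFin \o f)); last exact/measurable_EFinP.
by apply: filterS fg => w /= -> _.
Qed.

End complete.

Section ae_nonneg.
Context disp (T : measurableType disp) (R : realType).
Variables (P : {measure set T -> \bar R}) (f : T -> R).
Hypotheses (intf : P.-integrable setT (EFin \o f))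
           (f0 : {ae P, forall w, 0 <= f w}).

Lemma ae_ge0_integral_abs : (\int[P]_w `|(f w)%:E| = \int[P]_w (f w)%:E)%E.
Proof.
have mf := measurable_int P intf.
apply: ae_eq_integral => //; first exact: measurableT_comp.
by apply: filterS f0 => w fw _ /=; rewrite ger0_norm.
Qed.

Lemma ae_ge0_Rintegral_ge0 : 0 <= \int[P]_w f w.
Proof.
by rewrite /Rintegral -ae_ge0_integral_abs fine_ge0// integral_ge0.
Qed.

Lemma ae_ge0_Rintegral_eq0 : \int[P]_w f w <= 0 -> {ae P, forall w, f w = 0}.
Proof.
move=> fle; have : (\int[P]_w `|(f w)%:E| = 0)%E.
  apply/eqP; rewrite eq_le integral_ge0// andbT ae_ge0_integral_abs.
  by rewrite -[leLHS]fineK ?lee_fin//; exact: integrable_fin_num.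
move/ae_eq_integral_abs => /(_ measurableT (measurable_int P intf)).
by apply: filterS => w /(_ I) /= [->].
Qed.

End ae_nonneg.

(** Both bounds use only the monotonicity [ge0_le_integral_nomeas]; the upper one
makes the integral finite, so that [fine] does not lose the lower one. *)
Lemma Rintegral_bounds disp (T : measurableType disp) (R : realType)
    (mu : {measure set T -> \bar R}) (D B : set T) (f : T -> R) (c k : R) :
  measurable D -> measurable B -> B `<=` D -> (mu D < +oo)%E -> 0 <= c ->
  (forall x, D x -> 0 <= f x <= k) -> (forall x, B x -> c <= f x) ->
  c * fine (mu B) <= \int[mu]_(x in D) f x <= k * fine (mu D).
Proof.
move=> mD mB BD Doo c0 fk cf.
have f0 x : D x -> (0 <= (f x)%:E)%E by move=> /fk /andP[]; rewrite lee_fin.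
have up : (\int[mu]_(x in D) (f x)%:E <= k%:E * mu D)%E.
  rewrite -integral_cst//; apply: ge0_le_integral_nomeas => // x /fk /andP[_].
  by rewrite lee_fin.
have lo : (c%:E * mu B <= \int[mu]_(x in D) (f x)%:E)%E.
  rewrite -integral_cst// -{1}(setIidr BD) integral_mkcondr.
  apply: ge0_le_integral_nomeas => x Dx; rewrite /patch; case: ifP => //.
  - by move=> /set_mem Bx; rewrite lee_fin cf.
  - by move=> _; exact: f0.
have Bfin : mu B \is a fin_num.
  rewrite ge0_fin_numE//; apply: le_lt_trans Doo.
  by apply: le_measure => //; apply: mem_set.
have Dfin : mu D \is a fin_num by rewrite ge0_fin_numE.
have Ifin : (\int[mu]_(x in D) (f x)%:E)%E \is a fin_num.
  rewrite ge0_fin_numE; last exact: integral_ge0.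
  by apply: le_lt_trans up _; rewrite -(fineK Dfin) -EFinM ltey.
apply/andP; split; rewrite -lee_fin EFinM /Rintegral !fineK//.
Qed.

(** * Euclidean geometry of convex bodies *)

Section euclidean.
Context {R : realType} {d : nat}.
Implicit Types (x y z p q : 'rV[R]_d) (A B : set 'rV[R]_d).

Lemma dotC x y : dot x y = dot y x.
Proof. by apply: eq_bigr => i _; rewrite mulrC. Qed.

Lemma dotDl x y z : dot (x + y) z = dot x z + dot y z.
Proof. by rewrite /dot -big_split/=; apply: eq_bigr => i _; rewrite mxE mulrDl. Qed.

Lemma dotZl k x y : dot (k *: x) y = k * dot x y.
Proof. by rewrite /dot mulr_sumr; apply: eq_bigr => i _; rewrite mxE mulrA. Qed.

Lemma dotDr x y z : dot x (y + z) = dot x y + dot x z.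
Proof. by rewrite dotC dotDl !(dotC x). Qed.

Lemma dotZr k x y : dot x (k *: y) = k * dot x y.
Proof. by rewrite dotC dotZl dotC. Qed.

Lemma dotNl x y : dot (- x) y = - dot x y.
Proof. by rewrite -scaleN1r dotZl mulN1r. Qed.

Lemma dotNr x y : dot x (- y) = - dot x y.
Proof. by rewrite dotC dotNl dotC. Qed.

Lemma dotBl x y z : dot (x - y) z = dot x z - dot y z.
Proof. by rewrite dotDl dotNl. Qed.

Lemma dotBr x y z : dot x (y - z) = dot x y - dot x z.
Proof. by rewrite dotDr dotNr. Qed.

Lemma dot0r x : dot x 0 = 0.
Proof. by rewrite -(scale0r 0) dotZr mul0r. Qed.

Lemma dot_ge0 x : 0 <= dot x x.
Proof. by apply: sumr_ge0 => i _; rewrite -expr2 sqr_ge0. Qed.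

Lemma dot_eq0 x : (dot x x == 0) = (x == 0).
Proof.
apply/idP/eqP => [|->]; last by rewrite dot0r.
rewrite psumr_eq0 => [/allP h|i _]; last by rewrite -expr2 sqr_ge0.
apply/rowP => i; rewrite mxE.
by have /implyP := h i (mem_index_enum i); rewrite -expr2 sqrf_eq0 => /(_ isT)/eqP.
Qed.

Lemma dot_delta x i : dot x (delta_mx 0 i) = x 0 i.
Proof.
rewrite /dot (bigD1 i)//= big1 ?addr0 => [|j ji]; rewrite mxE eqxx/=.
  by rewrite eqxx mulr1.
by rewrite (negbTE ji) mulr0.
Qed.

Lemma enorm_ge0 x : 0 <= enorm x. Proof. exact: sqrtr_ge0. Qed.

Lemma sqr_enorm x : enorm x ^+ 2 = dot x x.
Proof. by rewrite sqr_sqrtr ?dot_ge0. Qed.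

Lemma enorm_eq0 x : (enorm x == 0) = (x == 0).
Proof. by rewrite -(sqrf_eq0 (enorm x)) sqr_enorm dot_eq0. Qed.

Lemma enorm_gt0 x : (0 < enorm x) = (x != 0).
Proof. by rewrite lt_neqAle enorm_ge0 andbT eq_sym enorm_eq0. Qed.

Lemma enorm0 : enorm (0 : 'rV[R]_d) = 0.
Proof. by apply/eqP; rewrite enorm_eq0. Qed.

Lemma enormZ k x : enorm (k *: x) = `|k| * enorm x.
Proof.
by rewrite /enorm dotZl dotZr mulrA -expr2 sqrtrM ?sqr_ge0// sqrtr_sqr.
Qed.

Lemma enormN x : enorm (- x) = enorm x.
Proof. by rewrite -scaleN1r enormZ normrN1 mul1r. Qed.

Lemma enormB x y : enorm (x - y) = enorm (y - x).
Proof. by rewrite -enormN opprB. Qed.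

Lemma cauchy_schwarz x y : dot x y <= enorm x * enorm y.
Proof.
have [->|y0] := eqVneq y 0; first by rewrite dot0r enorm0 mulr0.
have [->|x0] := eqVneq x 0; first by rewrite dotC dot0r enorm0 mul0r.
have /= := dot_ge0 (enorm y *: x - enorm x *: y).
rewrite dotBl !dotBr !dotZl !dotZr (dotC y x) -!sqr_enorm.
have : 0 < enorm x by rewrite enorm_gt0.
have : 0 < enorm y by rewrite enorm_gt0.
set a := enorm x; set b := enorm y => b0 a0.
rewrite (_ : _ - _ = (2 * (a * b)) * (a * b - dot x y)); last by ring.
by rewrite pmulr_rge0 ?subr_ge0// !mulr_gt0.
Qed.

Lemma norm_dot_le x y : `|dot x y| <= enorm x * enorm y.
Proof.
rewrite ler_norml cauchy_schwarz andbT lerNl -dotNl.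
by apply: (le_trans (cauchy_schwarz _ _)); rewrite enormN.
Qed.

Lemma enormD_le x y : enorm (x + y) <= enorm x + enorm y.
Proof.
rewrite -ler_sqr ?nnegrE ?addr_ge0 ?enorm_ge0// sqr_enorm dotDl !dotDr.
rewrite (dotC y x) -!sqr_enorm; have := cauchy_schwarz x y; lra.
Qed.

Lemma coord_le_enorm x i : `|x 0 i| <= enorm x.
Proof.
rewrite -ler_sqr ?nnegrE ?enorm_ge0// sqr_enorm -normrX ger0_norm ?sqr_ge0//.
rewrite /dot (bigD1 i)//= -expr2 lerDl; apply: sumr_ge0 => j _.
by rewrite -expr2 sqr_ge0.
Qed.

Lemma enorm_delta (i : 'I_d) : enorm (delta_mx 0 i : 'rV[R]_d) = 1.
Proof. by rewrite /enorm dot_delta mxE !eqxx sqrtr1. Qed.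

Lemma dot_continuous x : continuous (dot x).
Proof.
apply: continuous_big => [|i _ y]; first exact: add_continuous.
by apply: continuousM; [exact: cst_continuous|exact: coord_continuous].
Qed.

Lemma dot_self_continuous : continuous (fun x : 'rV[R]_d => dot x x).
Proof.
apply: continuous_big => [|i _ y]; first exact: add_continuous.
by apply: continuousM; exact: coord_continuous.
Qed.

Lemma enorm_continuous : continuous (@enorm R d).
Proof.
move=> y; apply: (@continuous_comp _ _ _ (fun x => dot x x) Num.sqrt).
  exact: dot_self_continuous.
exact: sqrt_continuous.
Qed.

Section body.
Variables (A : set 'rV[R]_d) (bA : convex_body A).

Let A0 : A !=set0. Proof. by case: bA. Qed.
Let cA : compact A. Proof. by case: bA. Qed.

Lemma body_argmax (f : 'rV[R]_d -> R) : continuous f ->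
  exists2 a, A a & forall b, A b -> f b <= f a.
Proof.
move=> cf; have [|a aA h] := @EVT_max_rV R d f A A0 cA.
  exact: continuous_subspaceT.
by exists a; [rewrite inE in aA|move=> b Ab; apply: h; rewrite inE].
Qed.

Lemma body_argmin (f : 'rV[R]_d -> R) : continuous f ->
  exists2 a, A a & forall b, A b -> f a <= f b.
Proof.
move=> cf; have [|a aA h] := @EVT_min_rV R d f A A0 cA.
  exact: continuous_subspaceT.
by exists a; [rewrite inE in aA|move=> b Ab; apply: h; rewrite inE].
Qed.

Lemma body_segment a b (t : R) : A a -> A b -> 0 <= t <= 1 ->
  A (a + t *: (b - a)).
Proof.
move=> Aa Ab /andP[t0 t1]; have [_ _ vA] := bA.
have t01 : (0 <= t <= 1) by rewrite t0.
have := vA b a (Itv01 t0 t1) (mem_set Ab) (mem_set Aa); rewrite inE.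
by congr A; rewrite /conv/= scalerBr scalerBl scale1r addrCA.
Qed.

(** Compactness: the supremum in the support function is a maximum. *)
Lemma support_attained x :
  exists2 a, A a & support_fun A x = dot x a /\ forall b, A b -> dot x b <= dot x a.
Proof.
have [a Aa h] := body_argmax (@dot_continuous x); exists a => //; split => //.
apply/eqP; rewrite eq_le; apply/andP; split.
  by apply: ge_sup => [|_ [b Ab <-]]; [exists (dot x a), a|exact: h].
by apply: ub_le_sup; [exists (dot x a) => _ [b Ab <-]; exact: h|exists a].
Qed.

Lemma dot_le_support x a : A a -> dot x a <= support_fun A x.
Proof. by move=> Aa; have [b Ab [-> h]] := support_attained x; exact: h. Qed.

Lemma support_le x (c : R) : (forall a, A a -> dot x a <= c) ->
  support_fun A x <= c.
Proof. by move=> h; have [b Ab [-> _]] := support_attained x; exact: h. Qed.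

Lemma support_norm_le x (c : R) : (forall a, A a -> enorm a <= c) ->
  `|support_fun A x| <= enorm x * c.
Proof.
move=> h; have [b Ab [-> _]] := support_attained x.
by apply: (le_trans (norm_dot_le _ _)); rewrite ler_wpM2l ?enorm_ge0// h.
Qed.

(** Moving the direction moves every scalar product with the body by a bounded
multiple of the displacement. *)
Lemma support_lipschitz x y (c : R) : (forall a, A a -> enorm a <= c) ->
  `|support_fun A x - support_fun A y| <= enorm (x - y) * c.
Proof.
move=> h.
have key u v : support_fun A u - support_fun A v <= enorm (u - v) * c.
  have [a Aa [-> _]] := support_attained u.
  rewrite lerBlDr -lerBlDl; apply: le_trans (dot_le_support v Aa).
  rewrite lerBlDr -lerBlDl -dotBl; apply: (le_trans (cauchy_schwarz _ _)).
  by rewrite ler_wpM2l ?enorm_ge0// h.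
by rewrite ler_norml key andbT lerNl opprB enormB key.
Qed.

Lemma body_bounded : exists2 c : R, 0 <= c & forall a, A a -> enorm a <= c.
Proof.
have [a Aa h] := body_argmax enorm_continuous.
by exists (enorm a); rewrite ?enorm_ge0.
Qed.

End body.

Lemma support_mink A B x : convex_body A -> convex_body B ->
  support_fun (mink A B) x = support_fun A x + support_fun B x.
Proof.
move=> bA bB; have [a Aa [sa ha]] := support_attained bA x.
have [b Bb [sb hb]] := support_attained bB x.
have h c : mink A B c -> dot x c <= dot x (a + b).
  by case=> a' Aa' [b' Bb' <-]; rewrite !dotDr lerD ?ha ?hb.
rewrite sa sb -dotDr; apply/eqP; rewrite eq_le; apply/andP; split.
  apply: ge_sup => [|_ [c Cc <-]]; last exact: h.
  by exists (dot x (a + b)), (a + b) => //; exists a => //; exists b.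
apply: ub_le_sup; first by exists (dot x (a + b)) => _ [c Cc <-]; exact: h.
by exists (a + b) => //; exists a => //; exists b.
Qed.

Lemma support_set1 a x : support_fun [set a] x = dot x a.
Proof. by rewrite /support_fun image_set1 sup1. Qed.

Lemma convex_body_set1 (a : 'rV[R]_d) : convex_body [set a].
Proof.
split; [by exists a|exact: compact_set1|].
move=> x y t; rewrite !inE => -> ->.
by rewrite /conv/= -scalerDl addrC subrK scale1r.
Qed.

Lemma hausdorff_dist_sym A B : hausdorff_dist A B = hausdorff_dist B A.
Proof.
rewrite /hausdorff_dist maxC; congr (Num.max (sup _) (sup _));
  by apply/funext => r; apply/propext; split => -[a Aa <-]; exists a => //;
  congr inf; apply/funext => s; apply/propext; split => -[b Bb <-]; exists b => //;
  rewrite enormB.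
Qed.

(** The boundedness of the two bodies makes the suprema in the Hausdorff distance
genuine upper bounds. *)
Lemma hausdorff_near A B (e : R) a : convex_body A -> convex_body B ->
  hausdorff_dist A B < e -> A a -> exists2 b, B b & enorm (a - b) < e.
Proof.
move=> bA bB; rewrite gt_max => /andP[+ _] Aa.
have [[b0 Bb0] _ _] := bB.
have [c _ hc] := body_bounded bA.
have lb u : has_lbound [set enorm (u - b) | b in B].
  by exists 0 => _ [b _ <-]; exact: enorm_ge0.
move=> h; have ai : inf [set enorm (a - b) | b in B] < e.
  apply: le_lt_trans h; apply: ub_le_sup; last by exists a.
  exists (c + enorm b0) => _ [u Au <-].
  apply: le_trans (ge_inf (lb u) _) _; first by exists b0.
  by apply: (le_trans (enormD_le _ _)); rewrite enormN lerD2r hc.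
have [|_ [b Bb <-] lt] := inf_lt _ ai; first by exists (enorm (a - b0)), b0.
by exists b.
Qed.

Lemma support_hausdorff A B (e : R) x : convex_body A -> convex_body B ->
  hausdorff_dist A B < e ->
  `|support_fun A x - support_fun B x| <= enorm x * e.
Proof.
have key A' B' : convex_body A' -> convex_body B' -> hausdorff_dist A' B' < e ->
    support_fun A' x - support_fun B' x <= enorm x * e.
  move=> bA bB AB; have [a Aa [-> _]] := support_attained bA x.
  have [b Bb ab] := hausdorff_near bA bB AB Aa.
  apply: (@le_trans _ _ (dot x (a - b))).
    by rewrite dotBr; have := dot_le_support bB x Bb; lra.
  apply: (le_trans (cauchy_schwarz _ _)).
  by rewrite ler_wpM2l ?enorm_ge0// ltW.
move=> bA bB AB; rewrite ler_norml key// andbT lerNl opprB key//.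
by rewrite hausdorff_dist_sym.
Qed.

Definition nearest A p q := A q /\ forall a, A a -> enorm (p - q) <= enorm (p - a).

(** The metric projection onto a convex body. Among all measurable selections it is
the convenient one: it depends continuously on the body, and far away points
project close to the support face in their direction. *)
Definition body_proj A p := xget 0 (nearest A p).

Lemma body_proj_nearest A p : convex_body A -> nearest A p (body_proj A p).
Proof.
move=> bA; have cf : continuous (fun a : 'rV[R]_d => enorm (p - a)).
  move=> a; apply: (@continuous_comp _ _ _ (fun a : 'rV[R]_d => p - a)).
    by apply: continuousB; [exact: cst_continuous|exact: cvg_id].
  exact: enorm_continuous.
have [q Aq h] := body_argmin bA cf.
by apply: (xgetPex 0); exists q.
Qed.

Lemma body_proj_in A p : convex_body A -> A (body_proj A p).
Proof. by move=> /(body_proj_nearest p)[]. Qed.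

(** If the angle were acute, a short step from the projection towards [a] would get
closer to [p]. *)
Lemma body_proj_obtuse A p a : convex_body A -> A a ->
  dot (p - body_proj A p) (a - body_proj A p) <= 0.
Proof.
move=> bA Aa; have [Aq h] := body_proj_nearest p bA; set q := body_proj A p in Aq h *.
rewrite leNgt; apply/negP => c0; set c := dot _ _ in c0.
pose D := dot (a - q) (a - q).
(* The step [c / D] would be optimal; adding [c] keeps it below 1. *)
have D0 : 0 <= D by exact: dot_ge0.
pose t := c / (c + D).
have cD : 0 < c + D by rewrite ltr_pwDl.
have t0 : 0 < t by rewrite divr_gt0.
have t1 : t <= 1 by rewrite ler_pdivrMr// mul1r lerDl.
have := h _ (body_segment bA Aq Aa (t := t) _); rewrite (ltW t0) t1 => /(_ isT).
rewrite -ler_sqr ?nnegrE ?enorm_ge0// !sqr_enorm.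
rewrite (_ : p - (q + t *: (a - q)) = (p - q) - t *: (a - q)); last first.
  by rewrite opprD addrA.
have sq (u v : 'rV[R]_d) : dot (u - t *: v) (u - t *: v)
    = dot u u - 2 * t * dot u v + t ^+ 2 * dot v v.
  by rewrite dotBl !dotBr !dotZl !dotZr (dotC v u); ring.
rewrite sq -/c -/D => {}h.
have {h} : 2 * c <= t * D by rewrite -(ler_pM2l t0); lra.
rewrite leNgt => /negP; apply; rewrite /t -mulrA.
have : D / (c + D) <= 1 by rewrite ler_pdivrMr// mul1r lerDr ltW.
rewrite mulrCA [_^-1 * _]mulrC => hD.
have : c * (D / (c + D)) <= c * 1 by rewrite ler_pM2l.
lra.
Qed.

(** With [q] and [q'] the two projections of [p] and [a], [b] points of [A], [B] at
distance less than [r] of [q'], [q], adding the obtuse angle inequalities at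
[q] and [q'] gives [|q - q'| ^ 2 <= r (|p - q| + |p - q'|)]. *)
Lemma body_proj_hausdorff A p (e : R) : convex_body A -> 0 < e ->
  exists2 r, 0 < r & forall B, convex_body B -> hausdorff_dist A B < r ->
    enorm (body_proj A p - body_proj B p) < e.
Proof.
move=> bA e0; set q := body_proj A p; set D := enorm (p - q).
have D0 : 0 <= D by exact: enorm_ge0.
pose r := Num.min (e / 2) (e ^+ 2 / (4 * D + 1)).
have D1 : 0 < 4 * D + 1 by rewrite ltr_pwDr// mulr_ge0.
exists r; first by rewrite lt_min !divr_gt0// exprn_gt0.
move=> B bB AB; set q' := body_proj B p; set t := enorm (q - q').
rewrite ltNge; apply/negP => et.
have Aq : A q by exact: body_proj_in.
have Bq : B q' by exact: body_proj_in.
have [b Bb qb] := hausdorff_near bA bB AB Aq.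
have BA : hausdorff_dist B A < r by rewrite hausdorff_dist_sym.
have [a Aa qa] := hausdorff_near bB bA BA Bq.
have h1 := body_proj_obtuse p bA Aa; have h2 := body_proj_obtuse p bB Bb.
rewrite -/q -/q' in h1 h2.
(* The terms with [b - q'] and [a - q] are nonpositive by the obtuse angles. *)
have tE : t ^+ 2 = dot (p - q') (q - b) + dot (p - q') (b - q')
    + dot (p - q) (q' - a) + dot (p - q) (a - q).
  by rewrite sqr_enorm !dotBl !dotBr; ring.
have pq' : enorm (p - q') <= D + t.
  by apply: le_trans (enormD_le _ _); rewrite addrA subrK.
have u1 : dot (p - q') (q - b) <= (D + t) * r.
  apply: (le_trans (cauchy_schwarz _ _)).
  by rewrite ler_pM ?enorm_ge0// ltW.
have u2 : dot (p - q) (q' - a) <= D * r.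
  apply: (le_trans (cauchy_schwarz _ _)).
  by rewrite ler_wpM2l ?enorm_ge0// ltW.
have t0 : 0 < t by exact: lt_le_trans et.
have tt : t ^+ 2 <= (2 * D + t) * r by rewrite tE; lra.
have r1 : t * r <= t * (t / 2).
  rewrite ler_pM2l//; apply: (@le_trans _ _ (e / 2)); first by rewrite ge_min lexx.
  by rewrite ler_pM2r.
have r0 : 0 < r by rewrite lt_min !divr_gt0// exprn_gt0.
have r2 : r * (4 * D + 1) <= t ^+ 2.
  rewrite -ler_pdivlMr//; apply: (@le_trans _ _ (e ^+ 2 / (4 * D + 1))).
    by rewrite ge_min lexx orbT.
  by rewrite ler_pM2r ?invr_gt0// ler_sqr ?nnegrE// ltW.
by nra.
Qed.

(** The projection [q] of [k x] minimizes [|a| ^ 2 - 2 k (x . a)] on [A], so it loses at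
most [|a| ^ 2 / (2 k)] against a point [a] that maximizes [x . a]. *)
Lemma support_body_proj_gap A x (k c : R) : convex_body A -> 0 < k ->
  (forall a, A a -> dot a a <= c) ->
  support_fun A x <= dot x (body_proj A (k *: x)) + c / (2 * k).
Proof.
move=> bA k0 hc; have [Aq h] := body_proj_nearest (k *: x) bA.
have [a Aa [-> _]] := support_attained bA x; set q := body_proj _ _ in Aq h *.
have := h _ Aa; rewrite -ler_sqr ?nnegrE ?enorm_ge0// !sqr_enorm.
rewrite !dotBl !dotBr !dotZl !dotZr (dotC q x) (dotC a x) => {}h.
have k2 : 0 < 2 * k by rewrite mulr_gt0.
rewrite -lerBlDl ler_pdivlMr//.
have := hc _ Aa; have := dot_ge0 q; set u := dot x a in h *.
set v := dot x q in h *; lra.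
Qed.

Lemma in_body_of_proj A z : convex_body A ->
  (dot (z - body_proj A z) (z - body_proj A z) <= 0) -> A z.
Proof.
move=> bA h; have : dot (z - body_proj A z) (z - body_proj A z) == 0.
  by rewrite eq_le h dot_ge0.
by rewrite dot_eq0 subr_eq0 => /eqP ->; exact: body_proj_in.
Qed.

End euclidean.

(** * Lebesgue measure of row vectors *)

Section boxes.
Context {R : realType}.
Notation mu := (@lebesgue_measure R).

Definition box n (B : 'I_n -> set R) : set 'rV[R]_n :=
  [set x | forall i, B i (x 0 i)].

Lemma measurable_box n (B : 'I_n -> set R) :
  (forall i, measurable (B i)) -> measurable (box B).
Proof.
move=> mB; rewrite (_ : box B = \bigcap_(i in [set: 'I_n])
    ((fun x : 'rV[R]_n => x 0 i) @^-1` B i)); last first.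
  by apply/seteqP; split => [x Bx i _|x Bx i]; [exact: Bx|exact: (Bx i)].
apply: fin_bigcap_measurable; first exact: finite_finset.
move=> i _; rewrite -[X in measurable X]setTI.
exact: (measurable_coord i).
Qed.

Lemma lebesgue_rV_box n (B : 'I_n -> set R) : (forall i, measurable (B i)) ->
  lebesgue_rV n (box B) = (\prod_(i < n) mu (B i))%E.
Proof.
elim: n B => [|n IH] B mB.
  by rewrite big_ord0 /= diracE mem_set// => -[].
rewrite big_ord_recl /= /lebesgue_step /pushforward.
rewrite (_ : _ @^-1` _ = B ord0 `*` box (fun i => B (lift ord0 i))).
  by rewrite product_measure1E ?IH//; [exact: mB|exact: measurable_box].
apply/seteqP; split => [[a x] Bx|[a x] [/= Ba Bx] i].
  split => [|i] /=; first by have := Bx ord0; rewrite rV_cons0.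
  by have := Bx (lift ord0 i); rewrite rV_consS.
by case: (unliftP ord0 i) => [j|] ->; rewrite ?rV_consS ?rV_cons0//; exact: Bx.
Qed.

(** The boxes form a system that is stable under intersection, generates the
sigma-algebra, and contains an exhaustion by sets of finite measure. *)
Lemma measure_rV_unique n (m : {measure set 'rV[R]_n -> \bar R}) :
  (forall B : 'I_n -> set R, (forall i, measurable (B i)) ->
    m (box B) = lebesgue_rV n (box B)) ->
  forall A, measurable A -> m A = lebesgue_rV n A.
Proof.
move=> mE A mA.
pose G := [set A | exists2 B : 'I_n -> set R, (forall i, measurable (B i)) & A = box B].
pose g (k : nat) : set 'rV[R]_n := box (fun _ : 'I_n => `[- k%:R, k%:R]%classic).
have Gg k : G (g k) by exists (fun _ => `[- k%:R, k%:R]%classic).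
apply/esym; apply: (@measure_unique _ _ _ G g) => //.
- apply/seteqP; split.
    apply: smallest_sub; first exact: smallest_sigma_algebra.
    case: n @G {m mE A mA g Gg} => [|n] G; first by rewrite big_ord0.
    rewrite -bigcup_mkord_ord; apply: bigcup_sub => i _ _ [B mB <-].
    apply: sub_sigma_algebra; rewrite setTI.
    exists (fun j => if j == inord i then B else setT).
      by move=> j; case: ifP.
    apply/seteqP; split => [x /= Bx j|x /(_ (inord i))/=]; last by rewrite eqxx.
    by case: eqP => // ->.
  by apply: smallest_sub => [|_ [B mB ->]];
    [exact: sigma_algebra_measurable|exact: measurable_box].
- move=> _ _ [B mB ->] [C mC ->]; exists (fun i => B i `&` C i).
    by move=> i; exact: measurableI.
  by apply/seteqP; split => [x [h1 h2] i|x h]; [split|split => i; have [] := h i].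
- apply/seteqP; split => // x _.
  pose M := \sum_(i < n) `|x 0 i|.
  exists (Num.truncn M).+1 => // i /=; rewrite in_itv/= -ler_norml.
  apply: le_trans (ltW (truncnS_gt M)); rewrite /M (bigD1 i)//= lerDl.
  exact: sumr_ge0.
- by move=> _ [B mB ->]; rewrite mE.
- move=> k; suff : (lebesgue_rV n (g k) < +oo)%E by [].
  rewrite /g lebesgue_rV_box// -ge0_fin_numE ?prode_ge0//.
  by apply: prode_fin_num => i _; rewrite /= lebesgue_measure_itv; case: ifP.
Qed.



(** Open balls of the sup norm. They play the role of balls below since, unlike
Euclidean balls, they are boxes. *)
Definition cube n (c : 'rV[R]_n) (r : R) : set 'rV[R]_n :=
  box (fun i => `]c 0 i - r, c 0 i + r[%classic).

Lemma cubeP n (c x : 'rV[R]_n) r :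
  cube c r x <-> forall i, `|x 0 i - c 0 i| < r.
Proof.
by split=> h i; have := h i; rewrite /= in_itv/= ltr_distl.
Qed.

Lemma measurable_cube n (c : 'rV[R]_n) r : measurable (cube c r).
Proof. by apply: measurable_box => i; exact: measurable_itv. Qed.

Lemma lebesgue_cube_gt0 n (c : 'rV[R]_n) r : 0 < r -> (0 < lebesgue_rV n (cube c r))%E.
Proof.
move=> r0; rewrite lebesgue_rV_box//.
have h i : mu `]c 0 i - r, c 0 i + r[%classic = (2 * r)%:E.
  rewrite lebesgue_measure_itv/= lte_fin ltrD2l gtrN// -EFinB; congr EFin; ring.
rewrite (eq_bigr (fun _ => (2 * r)%:E))// prodEFin lte_fin.
by apply: prodr_gt0 => _ _; rewrite mulr_gt0.
Qed.

Lemma open_cube n (U : set 'rV[R]_n) x : open U -> U x ->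
  exists2 r, 0 < r & cube x r `<=` U.
Proof.
move=> oU Ux; have /nbhs_ballP[r /= r0 xU] : nbhs x U by exact: open_nbhs_nbhs.
exists r => // y /cubeP xy; apply: xU; split => // i j.
by rewrite ord1 /ball/= distrC.
Qed.

(** An open set is the union of the countably many rational cubes that it contains. *)
Lemma measurable_open_rV n (U : set 'rV[R]_n) : open U -> measurable U.
Proof.
move=> oU; pose c (q : 'rV[rat]_n) : 'rV[R]_n := \row_i ratr (q 0 i).
pose F (p : 'rV[rat]_n * nat) : set 'rV[R]_n :=
  if `[< cube (c p.1) p.2.+1%:R^-1 `<=` U >] then cube (c p.1) p.2.+1%:R^-1
  else set0.
rewrite (_ : U = \bigcup_p F p).
  apply: countable_bigcupT_measurable => [|p]; first exact: countableP.
  by rewrite /F; case: asboolP => // _; exact: measurable_box.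
apply/seteqP; split => [x Ux|x [p _]]; last first.
  by rewrite /F; case: asboolP => // h /h.
have [r r0 xU] := open_cube oU Ux.
pose k := Num.truncn (2 / r).
have k2 : k.+1%:R^-1 < r / 2 by
  rewrite -[ltRHS]invrK ltf_pV2 ?posrE ?invr_gt0 ?divr_gt0// invf_div truncnS_gt.
have hq (i : 'I_n) : exists q : rat, `|x 0 i - ratr q| < k.+1%:R^-1.
  have [|q] := @rat_in_itvoo R (x 0 i - k.+1%:R^-1) (x 0 i + k.+1%:R^-1).
    by rewrite ltrD2l gtrN//.
  by exists q; rewrite distrC ltr_distl.
have [q hq'] := choice hq.
have cq i : c (\row_i q i) 0 i = ratr (q i) by rewrite !mxE.
exists (\row_i q i, k) => //; rewrite /F; case: asboolP => [_|[]] /=.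
  by apply/cubeP => i; rewrite cq.
move=> y /cubeP qy; apply: xU; apply/cubeP => i.
have := qy i; have := hq' i; rewrite cq => h1 h2.
rewrite -(subrK (ratr (q i)) (y 0 i)) -addrA; apply: (le_lt_trans (ler_normD _ _)).
move: h1; rewrite distrC => h1.
by rewrite (splitr r) ltrD//; apply: lt_trans k2.
Qed.

Lemma measurable_continuous_rV n (f : 'rV[R]_n -> R) : continuous f ->
  measurable_fun setT f.
Proof.
move=> /continuousP cf.
apply: (measurability _ (RGenOpens.measurableE R)) => _ [_ [a [b ->] <-]].
by rewrite setTI; apply: measurable_open_rV; exact/cf/interval_open.
Qed.

Lemma lebesgue_oppr (A : set R) : measurable A -> mu (-%R @^-1` A) = mu A.
Proof.
move=> mA; have mN : measurable_fun [set: measurableTypeR R]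
    (-%R : measurableTypeR R -> measurableTypeR R) by exact: oppr_measurable.
pose m := measure_function_pushforward__canonical__measure_function_Measure mu mN.
suff : mu A = m A by [].
apply: (@lebesgue_measure_unique R m) => // _ [[a b] _ <-].
have -> : m `]a, b]%classic = mu `[-b, -a[%classic.
  congr (mu _); apply/seteqP; split => x /=; rewrite !in_itv/= => /andP[h1 h2];
  by apply/andP; lra.
by rewrite !lebesgue_measure_itv/= !lte_fin ltrN2; case: ifP; rewrite // opprK addrC.
Qed.

Lemma lebesgue_sign (b : bool) (A : set R) : measurable A ->
  mu ((fun t => (-1) ^+ b * t) @^-1` A) = mu A.
Proof.
case: b => mA; last by congr mu; apply/seteqP; split => x /=; rewrite expr0 mul1r.
rewrite -[RHS]lebesgue_oppr//; congr mu; apply/seteqP.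
by split => x /=; rewrite expr1 mulN1r.
Qed.

Section signed_permutation.
Context (n : nat) (b : 'I_n -> bool) (s : 'S_n).

(** The symmetries of the cube: Euclidean isometries that permute the coordinates and
change signs. They map boxes to boxes, so that their invariance is a computation
on boxes, and they suffice to compute the second moments of the sphere. *)
Definition signed_perm (x : 'rV[R]_n) : 'rV[R]_n :=
  \row_i ((-1) ^+ b i * x 0 (s i)).

Lemma measurable_signed_perm : measurable_fun setT signed_perm.
Proof.
apply/measurable_rowP => i; rewrite (_ : (fun _ => _) =
  (fun x : 'rV[R]_n => (-1) ^+ b i * x 0 (s i))).
  by apply: measurable_funM => //; exact: measurable_coord.
by apply/funext => x; rewrite mxE.
Qed.

Lemma lebesgue_signed_perm (A : set 'rV[R]_n) : measurable A ->
  lebesgue_rV n (signed_perm @^-1` A) = lebesgue_rV n A.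
Proof.
pose m : {measure set 'rV[R]_n -> \bar R} :=
  measure_function_pushforward__canonical__measure_function_Measure
    (lebesgue_rV n) measurable_signed_perm.
apply: (@measure_rV_unique n m) => B mB; rewrite /m/= /pushforward.
have mS i : measurable ((fun t : R => (-1) ^+ b i * t) @^-1` B i).
  rewrite -[X in measurable X]setTI.
  suff : measurable_fun [set: R] (fun t : R => (-1) ^+ b i * t) by exact.
  exact: measurable_funM.
rewrite (_ : _ @^-1` _ = box (fun j =>
    (fun t => (-1) ^+ b ((s^-1)%g j) * t) @^-1` B ((s^-1)%g j))).
  rewrite !lebesgue_rV_box//.
  rewrite [RHS](reindex_perm (s^-1)%g)/=.
  by apply: eq_bigr => j _; rewrite lebesgue_sign.
apply/seteqP; split => x h j /=; first by have := h ((s^-1)%g j); rewrite mxE permKV.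
by have := h (s j); rewrite /= permK mxE.
Qed.

Lemma dot_signed_perm x y : dot (signed_perm x) (signed_perm y) = dot x y.
Proof.
rewrite /dot [RHS](reindex_perm s)/=; apply: eq_bigr => i _.
by rewrite !mxE mulrACA -expr2 sqrr_sign mul1r.
Qed.

End signed_permutation.

End boxes.

(** * Caps and second moments of the sphere *)

Section sphere_theory.
Context {R : realType} {d : nat} (d_gt0 : (0 < d)%N).
Notation sigma := (@surface R d).
Notation S := (@sphere R d).
Notation vol := (@unit_ball_volume R d).
Implicit Types (x y u a : 'rV[R]_d).

Lemma measurable_sphere : measurable S.
Proof.
rewrite (_ : S = setT `&` (@enorm R d) @^-1` [set 1]); last by rewrite setTI.
exact: measurable_enorm.
Qed.

Lemma measurable_cap (c : R) a : measurable (S `&` [set u | c < dot u a]).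
Proof.
apply: measurableI; first exact: measurable_sphere.
rewrite (_ : [set u | _] = setT `&` dot a @^-1` `]c, +oo[%classic).
  by apply: (measurable_continuous_rV (@dot_continuous R d a)).
by rewrite setTI; apply/seteqP; split => u /=; rewrite in_itv/= andbT dotC.
Qed.

Lemma measurable_ball1 : measurable (@ball1 R d).
Proof.
rewrite (_ : ball1 = setT `&` (@enorm R d) @^-1` `]-oo, 1]%classic).
  exact: measurable_enorm.
by rewrite setTI; apply/seteqP; split => x /=; rewrite in_itv.
Qed.

Lemma lebesgue_ball1_fin : (lebesgue_rV d (@ball1 R d) < +oo)%E.
Proof.
apply: (@le_lt_trans _ _ (lebesgue_rV d (cube 0 2))).
  apply: le_measure;
    [by apply: mem_set; exact: measurable_ball1|by apply: mem_set; exact: measurable_cube|].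
  move=> x x1; apply/cubeP => i; rewrite mxE subr0.
  by rewrite (le_lt_trans (coord_le_enorm x i))// (le_lt_trans (x1 : enorm x <= 1))// ltr1n.
rewrite lebesgue_rV_box// -ge0_fin_numE ?prode_ge0//.
by apply: prode_fin_num => i _; rewrite /= lebesgue_measure_itv; case: ifP.
Qed.

Lemma lebesgue_ball1_gt0 : (0 < lebesgue_rV d (@ball1 R d))%E.
Proof.
pose r : R := d%:R^-1.
have r0 : 0 < r by rewrite invr_gt0 ltr0n.
apply: lt_le_trans (lebesgue_cube_gt0 0 r0) _.
apply: le_measure; [by apply: mem_set; exact: measurable_cube|by apply: mem_set; exact: measurable_ball1|].
move=> x /cubeP xr; rewrite /ball1/= -(@expr_le1 _ 2) ?enorm_ge0// sqr_enorm.
apply: (@le_trans _ _ (\sum_(i < d) r)).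
  apply: ler_sum => i _; rewrite -expr2 -(real_normK (num_real _)).
  have := xr i; rewrite mxE subr0 => xi.
  apply: (@le_trans _ _ (r ^+ 2)); first by rewrite ler_sqr ?nnegrE ?(ltW xi)// ltW.
  by rewrite expr2 ger_pMl// invf_le1 ?ltr0n// ler1n.
by rewrite sumr_const card_ord -mulr_natr mulVf// pnatr_eq0 -lt0n.
Qed.

Lemma lebesgue_ball1 : lebesgue_rV d (@ball1 R d) = vol%:E.
Proof.
rewrite /unit_ball_volume fineK// ge0_fin_numE ?lebesgue_ball1_fin//.
Qed.

Lemma unit_ball_volume_gt0 : 0 < vol.
Proof. by rewrite -lte_fin -lebesgue_ball1 lebesgue_ball1_gt0. Qed.

(** The origin, removed from the ball, is a null box. *)
Lemma lebesgue_punctured_ball1 :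
  lebesgue_rV d (@punctured_ball1 R d) = vol%:E.
Proof.
have mp := @measurable_punctured_ball1 R d.
have z : lebesgue_rV d [set (0 : 'rV[R]_d)] = 0%E.
  rewrite (_ : [set 0] = box (fun _ : 'I_d => [set (0:R)])); last first.
    apply/seteqP; split => [x -> i|x h] /=; first by rewrite mxE.
    by apply/rowP => i; rewrite mxE; exact: h.
  rewrite lebesgue_rV_box//; case: d d_gt0 => // n _.
  by rewrite big_ord_recl lebesgue_measure_set1 mul0e.
have mz : measurable [set (0 : 'rV[R]_d)].
  rewrite (_ : [set 0] = ball1 `\` punctured_ball1).
    by apply: measurableD => //; exact: measurable_ball1.
  apply/seteqP; split => [_ ->|x [x1 /negP]].
    split; first by rewrite /ball1/= enorm0.
    by rewrite /punctured_ball1/= enorm0 ltxx.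
  by rewrite (x1 : enorm x <= 1) andbT enorm_gt0 negbK => /eqP.
rewrite -lebesgue_ball1 (_ : ball1 = punctured_ball1 `|` [set (0 : 'rV[R]_d)]).
  rewrite measureU//.
    by rewrite -[LHS]adde0; congr (_ + _)%E; exact/esym/z.
  by apply/seteqP; split => // x [/andP[+ _] x0]; rewrite (x0 : x = 0) enorm0 ltxx.
apply/seteqP; split => [x x1|x [/andP[]//|->]]; last by rewrite /ball1/= enorm0.
have [->|x0] := eqVneq x 0; first by right.
by left; rewrite /punctured_ball1/= enorm_gt0 x0.
Qed.

Lemma direction_sphere x : x != 0 -> S (direction x).
Proof.
move=> x0; rewrite /sphere/= enormZ ger0_norm ?invr_ge0 ?enorm_ge0//.
by rewrite mulVf// enorm_eq0.
Qed.

Lemma surface_sphere : sigma S = (d%:R * vol)%:E.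
Proof.
rewrite /surface EFinM -lebesgue_punctured_ball1; congr (_ * lebesgue_rV d _)%E.
apply/seteqP; split => [x []//|x px]; split => //.
by apply: direction_sphere; move: px => /andP[]; rewrite enorm_gt0.
Qed.

Lemma surface_sphere_lty : (sigma S < +oo)%E.
Proof. by rewrite surface_sphere ltey. Qed.

Lemma sphere_integrable (f : 'rV[R]_d -> R) (c : R) : measurable_fun setT f ->
  (forall u, S u -> `|f u| <= c) -> sigma.-integrable S (EFin \o f).
Proof.
move=> mf fc; apply: measurable_bounded_integrable.
- exact: measurable_sphere.
- exact: surface_sphere_lty.
- exact: measurable_funTS.
- by exists c; split => [|M cM u Su]; [exact: num_real|
    exact: le_trans (fc _ Su) (ltW cM)].
Qed.

Section invariance.
Variables (b : 'I_d -> bool) (s : 'S_d).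
Let psi := @signed_perm R d b s.

Lemma enorm_signed_perm x : enorm (psi x) = enorm x.
Proof. by rewrite /enorm dot_signed_perm. Qed.

Lemma direction_signed_perm x : direction (psi x) = psi (direction x).
Proof.
rewrite /direction enorm_signed_perm; apply/rowP => i.
by rewrite !mxE mulrCA.
Qed.

Lemma surface_signed_perm (A : set 'rV[R]_d) : measurable A ->
  sigma (psi @^-1` A) = sigma A.
Proof.
move=> mA; rewrite /surface; congr (_ * _)%E.
rewrite -[RHS](lebesgue_signed_perm b s).
  congr (lebesgue_rV d _); apply/seteqP; split => x /=;
  rewrite /punctured_ball1/= -/psi enorm_signed_perm direction_signed_perm//.
apply: measurableI; last exact: measurable_punctured_ball1.
rewrite -[X in measurable X]setTI; exact: measurable_direction.
Qed.

Lemma sphere_Rintegral_signed_perm (f : 'rV[R]_d -> R) (c : R) :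
  measurable_fun setT f -> (forall u, S u -> `|f u| <= c) ->
  \int[sigma]_(u in S) f (psi u) = \int[sigma]_(u in S) f u.
Proof.
move=> mf fc; rewrite /Rintegral; congr fine.
have mpsi : measurable_fun setT psi := measurable_signed_perm b s.
have Spsi : psi @^-1` S = S.
  by apply/seteqP; split => u; rewrite /sphere/= enorm_signed_perm.
rewrite -{1}Spsi.
have := @integral_pushforward _ _ _ _ _ _ mpsi sigma S (EFin \o f).
move=> /(_ _ _ measurable_sphere) <-.
- apply: eq_measure_integral => A mA _; rewrite /pushforward.
  exact: surface_signed_perm.
- exact/measurable_EFinP.
- rewrite Spsi; apply: (@sphere_integrable (f \o psi) c).
    exact: measurableT_comp.
  by move=> u Su; apply: fc; rewrite -Spsi in Su.
Qed.

End invariance.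

Lemma sphere_coord_le u i : S u -> `|u 0 i| <= 1.
Proof. by move=> Su; rewrite (le_trans (coord_le_enorm u i))// Su. Qed.

Lemma measurable_coordM i j :
  measurable_fun setT (fun u : 'rV[R]_d => u 0 i * u 0 j).
Proof. by apply: measurable_funM; exact: measurable_coord. Qed.

Lemma sphere_coordM_le u i j : S u -> `|u 0 i * u 0 j| <= 1.
Proof. by move=> Su; rewrite normrM mulr_ile1// sphere_coord_le. Qed.

(** Changing the sign of one coordinate kills the mixed moments; exchanging two
coordinates makes the others equal; and they sum to the surface of the sphere,
which is [d] times the volume of the ball. *)
Lemma sphere_second_moment i j :
  \int[sigma]_(u in S) (u 0 i * u 0 j) = (i == j)%:R * vol.
Proof.
have [<-|ij] := eqVneq i j; last first.
  have := @sphere_Rintegral_signed_perm (fun k => k == i) 1%g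
    (fun u => u 0 i * u 0 j) 1 (measurable_coordM i j) (fun u => @sphere_coordM_le u i j).
  rewrite (@eq_Rintegral _ _ _ _ _ (fun u => (-1) * (u 0 i * u 0 j))); last first.
    move=> u _; rewrite !mxE !perm1 eqxx eq_sym (negbTE ij).
    by rewrite expr1 expr0 mul1r mulrA.
  rewrite RintegralZl; [|exact: measurable_sphere|]; last first.
    apply: (sphere_integrable (measurable_coordM i j)) => u.
    exact: sphere_coordM_le.
  rewrite mul0r; lra.
have h k : \int[sigma]_(u in S) (u 0 k * u 0 k) = \int[sigma]_(u in S) (u 0 i * u 0 i).
  rewrite -(@sphere_Rintegral_signed_perm (fun=> false) (tperm i k)
    (fun u => u 0 i * u 0 i) 1 (measurable_coordM i i) (fun u => @sphere_coordM_le u i i)).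
  by apply: eq_Rintegral => u _; rewrite !mxE tpermL expr0 mul1r.
have tot : \sum_(k < d) \int[sigma]_(u in S) (u 0 k * u 0 k) = d%:R * vol.
  transitivity (\int[sigma]_(u in S) dot u u).
    rewrite (Rintegral_sum measurable_sphere)//.
    move=> k; apply: (sphere_integrable (measurable_coordM k k)) => u.
    exact: sphere_coordM_le.
  rewrite (@eq_Rintegral _ _ _ _ _ (fun=> 1)).
    rewrite (Rintegral_cst _ measurable_sphere) mul1r.
    exact: (congr1 fine surface_sphere).
  by move=> u /set_mem Su; rewrite -sqr_enorm (Su : enorm u = 1) expr1n.
move: tot; under eq_bigr do rewrite h.
rewrite sumr_const card_ord -[LHS]mulr_natl => tot.
have d0 : d%:R != 0 :> R by rewrite pnatr_eq0 -lt0n.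
by rewrite (mulfI d0 tot) mul1r.
Qed.

(** The cone over the cap contains a neighbourhood of a small positive multiple of [a]. *)
Lemma surface_cap_gt0 a : a != 0 ->
  (0 < sigma (S `&` [set u | (enorm a / 2 < dot u a)%R]))%E.
Proof.
move=> a0; have na : 0 < enorm a by rewrite enorm_gt0.
(* A point of norm 1 / 2 in the direction of [a]. *)
pose x0 : 'rV[R]_d := (2 * enorm a)^-1 *: a.
pose U := [set x : 'rV[R]_d | enorm x < 1] `&`
          [set x : 'rV[R]_d | 0 < dot a x - enorm x * (enorm a / 2)].
have nx0 : enorm x0 = 2^-1.
  rewrite enormZ ger0_norm ?invr_ge0 ?mulr_ge0 ?enorm_ge0// invfM.
  by rewrite -mulrA mulVf ?mulr1// enorm_eq0.
have oU : open U.
  apply: openI.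
    have := @open_comp _ _ (@enorm R d) [set y | y < 1].
    apply; last exact: open_lt.
    by move=> x _; exact: enorm_continuous.
  have := @open_comp _ _ (fun x => dot a x - enorm x * (enorm a / 2)) [set y | 0 < y].
  apply; last exact: open_gt.
  move=> x _; apply: continuousB; first exact: dot_continuous.
  by apply: continuousM; [exact: enorm_continuous|exact: cst_continuous].
have Ux0 : U x0.
  split; rewrite /= nx0; first by rewrite invf_lt1 ?ltr1n.
  rewrite dotZr -sqr_enorm expr2 invfM mulrA -(mulrA 2^-1) mulVf ?gt_eqF// mulr1.
  lra.
have [r r0 rU] := open_cube oU Ux0.
rewrite /surface mule_gt0// ?lte_fin ?ltr0n//.
apply: lt_le_trans (lebesgue_cube_gt0 x0 r0) _.
apply: le_measure; first by apply: mem_set; exact: measurable_cube.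
  apply: mem_set; apply: measurableI; last exact: measurable_punctured_ball1.
  rewrite -[X in measurable X]setTI; apply: measurable_direction => //.
  exact: measurable_cap.
move=> x /rU [/= x1 ax].
have x0n : x != 0.
  by apply: contraTneq ax => ->; rewrite dot0r enorm0 mul0r subrr ltxx.
have nx : 0 < enorm x by rewrite enorm_gt0.
split; last by rewrite /punctured_ball1/= nx ltW.
split; first exact: direction_sphere.
by rewrite /= /direction dotZl ltr_pdivlMl// dotC -subr_gt0.
Qed.

End sphere_theory.

(** * Sums and translates of fuzzy sets *)

Section fuzzy_algebra.
Context {R : realType} {d : nat}.
Implicit Types (x y : 'rV[R]_d) (A B : set 'rV[R]_d) (nu mu : fuzzy R d).

Lemma level_body nu (a : R) : 0 <= a <= 1 -> convex_body (level nu a).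
Proof.
move=> a01; split; first exact: level_neq0.
  exact: compact_level.
exact: (fuzzy_convex (membershipP nu)).
Qed.

(** The membership degree of [x] is the greatest level whose set contains [x]. *)
Lemma fuzzy_ext_level nu mu :
  (forall a : R, 0 < a <= 1 -> level nu a = level mu a) -> nu = mu.
Proof.
have key nu' mu' : (forall a : R, 0 < a <= 1 -> level nu' a = level mu' a) ->
    forall x, nu' x <= mu' x.
  move=> h x; have /andP[n0 n1] := fuzzy01 (membershipP nu') x.
  have /andP[m0 _] := fuzzy01 (membershipP mu') x.
  move: n0; rewrite le_eqVlt => /predU1P[<-//|n0].
  have : level nu' (nu' x) x by rewrite level_pos/=.
  by rewrite h ?n0// level_pos.
move=> h; apply: fuzzy_ext => x; apply/eqP.
by rewrite eq_le !key// => a /h ->.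
Qed.

Lemma in_mink_set1 A x y : mink A [set x] y <-> A (y - x).
Proof.
split=> [[z Az [_ -> <-]]|Ayx]; first by rewrite addrK.
by exists (y - x) => //; exists x; rewrite ?subrK.
Qed.

Lemma level_fadd_findic nu x (a : R) : 0 <= a <= 1 ->
  level (nu \oplus findic x) a = mink (level nu a) [set x].
Proof. by move=> a01; rewrite level_fadd// level_findic_fun. Qed.

Lemma fadd_findicA nu mu x :
  nu \oplus mu \oplus findic x = nu \oplus (mu \oplus findic x).
Proof.
apply: fuzzy_ext_level => a /andP[/ltW a0 a1].
have a01 : 0 <= a <= 1 by rewrite a0.
rewrite level_fadd_findic// !level_fadd// level_findic_fun//.
apply/seteqP; split => y.
  move=> /in_mink_set1[u nu_u [v mu_v uv]]; exists u => //; exists (v + x).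
    by exists v => //; exists x.
  by rewrite addrA uv subrK.
move=> [u nu_u [_ [v mu_v [_ -> <-]] <-]]; apply/in_mink_set1.
by exists u => //; exists v; rewrite // addrA addrK.
Qed.

Lemma findicD x y : findic x \oplus findic y = findic (x + y).
Proof.
apply: fuzzy_ext_level => a /andP[/ltW a0 a1].
have a01 : 0 <= a <= 1 by rewrite a0.
rewrite level_fadd_findic// !level_findic_fun//.
apply/seteqP; split => z; first by move=> /in_mink_set1/= <-; rewrite subrK.
by move=> /= ->; apply/in_mink_set1; rewrite /= addrK.
Qed.

Lemma fadd_findic0 nu : nu \oplus findic 0 = nu.
Proof.
apply: fuzzy_ext_level => a /andP[/ltW a0 a1].
rewrite level_fadd_findic ?a0//; apply/seteqP.
by split => z; [move/in_mink_set1|move=> h; apply/in_mink_set1]; rewrite ?subr0.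
Qed.

Lemma fadd_findicK nu x : nu \oplus findic x \oplus findic (- x) = nu.
Proof. by rewrite fadd_findicA findicD subrr fadd_findic0. Qed.

Lemma fadd_findicKN nu x : nu \oplus findic (- x) \oplus findic x = nu.
Proof. by rewrite -{2}(opprK x) fadd_findicK. Qed.

End fuzzy_algebra.

Section support_measurability.
Context {R : realType} {d : nat}.
Implicit Types (A : set 'rV[R]_d).

Lemma support_continuous A : convex_body A -> continuous (support_fun A).
Proof.
move=> bA x; have [c c0 hc] := body_bounded bA.
move=> U /nbhs_ballP[e /= e0 xU].
have c1 : 0 < c + 1 by rewrite ltr_pwDr.
have cf : continuous (fun y : 'rV[R]_d => enorm (x - y)).
  move=> y; apply: (@continuous_comp _ _ _ (fun y : 'rV[R]_d => x - y)).
    by apply: continuousB; [exact: cst_continuous|exact: cvg_id].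
  exact: enorm_continuous.
have : nbhs (enorm (x - x)) [set r : R | r < e / (c + 1)].
  apply: open_nbhs_nbhs; split; first exact: open_lt.
  by rewrite /= subrr enorm0 divr_gt0.
move=> /(cf x); apply: (@filterS _ (nbhs x)) => y /= xy; apply: xU.
rewrite /ball/=; apply: (le_lt_trans (support_lipschitz bA _ _ hc)).
have : enorm (x - y) * (c + 1) < e by rewrite -ltr_pdivlMr.
by apply: le_lt_trans; rewrite ler_wpM2l ?enorm_ge0// lerDl.
Qed.

Lemma measurable_support A : convex_body A ->
  measurable_fun setT (support_fun A).
Proof. by move=> bA; apply: measurable_continuous_rV; exact: support_continuous. Qed.

Lemma support_sphere_le A (c : R) u : convex_body A ->
  (forall a, A a -> enorm a <= c) -> sphere u -> `|support_fun A u| <= c.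
Proof.
move=> bA hc Su; have := support_norm_le bA u hc.
by rewrite (Su : enorm u = 1) mul1r.
Qed.

End support_measurability.

(** * Translation of the generalized Steiner point *)

Section steiner_theory.
Context {R : realType} {d : nat} (d_gt0 : (0 < d)%N).
Notation sigma := (@surface R d).
Notation S := (@sphere R d).
Notation vol := (@unit_ball_volume R d).
Implicit Types (A : set 'rV[R]_d) (b : 'rV[R]_d) (nu mu : fuzzy R d).

Lemma measurable_support_mul A (g : 'rV[R]_d -> R) : convex_body A ->
  measurable_fun setT g -> measurable_fun setT (fun u => support_fun A u * g u).
Proof. by move=> bA mg; apply: measurable_funM => //; exact: measurable_support. Qed.

Lemma integrable_support_mul A (g : 'rV[R]_d -> R) : convex_body A ->
  measurable_fun setT g -> (forall u, S u -> `|g u| <= 1) ->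
  sigma.-integrable S (EFin \o (fun u : 'rV[R]_d => support_fun A u * g u)).
Proof.
move=> bA mg g1; have [c c0 hc] := body_bounded bA.
apply: (sphere_integrable d_gt0 (c := c)); first exact: measurable_support_mul.
move=> u Su; rewrite normrM -[leRHS]mulr1.
by rewrite ler_pM// ?g1// (support_sphere_le bA).
Qed.

(** A translation by [b] adds the integral of [(u . b) u] to the Steiner point: by
the second moments of the sphere this is the volume of the ball times [b]. *)
Lemma steiner_translate A b : convex_body A ->
  steiner (mink A [set b]) = steiner A + b.
Proof.
move=> bA; apply/rowP => i; rewrite !mxE.
have mS := @measurable_sphere R d.
rewrite (@eq_Rintegral _ _ _ _ _
  (fun u => support_fun A u * u 0 i + \sum_(j < d) b 0 j * (u 0 j * u 0 i))); last first.
  move=> u _; rewrite support_mink//; last exact: convex_body_set1.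
  rewrite support_set1 mulrDl; congr (_ + _).
  by rewrite /dot mulr_suml; apply: eq_bigr => j _; ring.
have iM (j : 'I_d) : sigma.-integrable S (EFin \o (fun u : 'rV[R]_d => u 0 j * u 0 i)).
  apply: (sphere_integrable d_gt0 (measurable_coordM j i)) => u.
  exact: sphere_coordM_le.
have iM' (j : 'I_d) : sigma.-integrable S (EFin \o (fun u : 'rV[R]_d => b 0 j * (u 0 j * u 0 i))).
  exact: (integrableZl mS (b 0 j) (iM j)).
rewrite RintegralD//; last 2 first.
- apply: integrable_support_mul => //; first exact: measurable_coord.
  by move=> u Su; exact: sphere_coord_le.
- exact: integrable_sum_EFin.
rewrite Rintegral_sum// mulrDr; congr (_ + _).
rewrite (bigD1 i)//= big1 ?addr0 => [|j ji]; rewrite RintegralZl//; try exact: iM.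
  rewrite sphere_second_moment// eqxx mul1r mulrCA mulVf ?mulr1//.
  by rewrite gt_eqF// unit_ball_volume_gt0.
by rewrite sphere_second_moment// (negbTE ji) mul0r mulr0.
Qed.

Lemma sphere_Rintegral_support_le A B (g : 'rV[R]_d -> R) :
  convex_body A -> convex_body B -> A `<=` B ->
  measurable_fun setT g -> (forall u, S u -> 0 <= g u <= 1) ->
  \int[sigma]_(u in S) (support_fun A u * g u)
  <= \int[sigma]_(u in S) (support_fun B u * g u).
Proof.
move=> bA bB AB mg g01.
have g1 u : S u -> `|g u| <= 1.
  by move=> /g01/andP[g0 g1]; rewrite ger0_norm.
apply: le_Rintegral => //; first exact: measurable_sphere.
- exact: integrable_support_mul.
- exact: integrable_support_mul.
move=> u /g01/andP[g0 _]; apply: ler_wpM2r => //.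
by apply: support_le => // a /AB Ba; exact: dot_le_support.
Qed.

(** The levels decrease, so the integral is a nonincreasing function of the level. *)
Lemma measurable_support_level nu (g : 'rV[R]_d -> R) :
  measurable_fun setT g -> (forall u, S u -> 0 <= g u <= 1) ->
  measurable_fun (`[0, 1]%classic : set R)
    (fun a : R => \int[sigma]_(u in S) (support_fun (level nu a) u * g u)).
Proof.
move=> mg g01.
(* Outside the unit interval a level is the whole space or empty, which breaks the
   monotonicity. *)
pose clamp (a : R) := Num.max 0 (Num.min a 1).
have clamp01 a : 0 <= clamp a <= 1.
  by rewrite le_max lexx ge_max ler01 ge_min lexx orbT.
apply: (@eq_measurable_fun _ _ _ _ _ (fun a : R =>
    \int[sigma]_(u in S) (support_fun (level nu (clamp a)) u * g u))).
  move=> a; rewrite inE/= in_itv/= => /andP[a0 a1].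
  by rewrite /clamp (min_idPl a1) (max_idPr a0).
apply: nonincreasing_measurable => // a b ab.
apply: sphere_Rintegral_support_le => //; try exact: level_body.
apply: level_anti; first by case/andP: (clamp01 a).
by rewrite /clamp le_max2// le_min2.
Qed.

(** Splitting a coordinate into its positive and negative parts writes the Steiner
point as a difference of two functions that are monotone in the level. *)
Lemma steiner_level_integrable nu i :
  lebesgue_measure.-integrable (`[0, 1]%classic : set R)
    (EFin \o (fun a : R => steiner (level nu a) 0 i)).
Proof.
pose gp (u : 'rV[R]_d) := Num.max (u 0 i) 0.
pose gn (u : 'rV[R]_d) := Num.max (- u 0 i) 0.
have mS := @measurable_sphere R d.
have mgp : measurable_fun setT gp.
  by apply: measurable_maxr => //; exact: measurable_coord.
have mgn : measurable_fun setT gn.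
  by apply: measurable_maxr => //; apply: measurable_funN; exact: measurable_coord.
have gp01 u : S u -> 0 <= gp u <= 1.
  move=> /(@sphere_coord_le R d u i); rewrite ler_norml => /andP[u1 u2].
  by rewrite /gp le_max lexx orbT ge_max u2 ler01.
have gn01 u : S u -> 0 <= gn u <= 1.
  move=> /(@sphere_coord_le R d u i); rewrite ler_norml lerNl => /andP[u1 u2].
  by rewrite /gn le_max lexx orbT ge_max u1 ler01.
have abs (g : 'rV[R]_d -> R) u : (0 <= g u <= 1) -> `|g u| <= 1.
  by move=> /andP[g0 g1]; rewrite ger0_norm.
have E a : 0 <= a <= 1 -> steiner (level nu a) 0 i = vol^-1 *
    (\int[sigma]_(u in S) (support_fun (level nu a) u * gp u) -
     \int[sigma]_(u in S) (support_fun (level nu a) u * gn u)).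
  move=> a01; rewrite mxE -RintegralB//; last 2 first.
  - by apply: integrable_support_mul => //; [exact: level_body|move=> u Su; exact: (abs gp u (gp01 u Su))].
  - by apply: integrable_support_mul => //; [exact: level_body|move=> u Su; exact: (abs gn u (gn01 u Su))].
  congr (_ * _); apply: eq_Rintegral => u _; rewrite -mulrBr; congr (_ * _).
  by rewrite /gp /gn; case: (leP (u 0 i) 0) => h; case: (leP (- u 0 i) 0) => h'; lra.
have [c c0 hc] := body_bounded (level_body nu (a := 0) (andb_true_intro (conj (lexx 0) ler01))).
apply: measurable_bounded_integrable => //.
- by rewrite /= lebesgue_measure_itv/= lte01 oppr0 addr0 ltey.
- apply: (@eq_measurable_fun _ _ _ _ _ (fun a => vol^-1 *
    (\int[sigma]_(u in S) (support_fun (level nu a) u * gp u) -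
     \int[sigma]_(u in S) (support_fun (level nu a) u * gn u)))).
    by move=> a; rewrite inE/= in_itv/= => /E ->.
  apply: measurable_funM => //.
  by apply: measurable_funB; exact: measurable_support_level.
pose k := vol^-1 * (c * fine (sigma S)).
exists k; split; first exact: num_real.
move=> M kM a /=; rewrite in_itv/= => a01; apply: le_trans (ltW kM).
have v0 : 0 <= vol^-1 by rewrite invr_ge0; exact/ltW/unit_ball_volume_gt0.
rewrite /k mxE normrM (ger0_norm v0) ler_wpM2l//.
have ba := level_body nu a01.
have intf : sigma.-integrable S (EFin \o (fun u : 'rV[R]_d => support_fun (level nu a) u * u 0 i)).
  apply: integrable_support_mul => //; first exact: measurable_coord.
  by move=> u Su; exact: sphere_coord_le.
apply: (le_trans (le_normr_Rintegral mS intf)).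
rewrite -Rintegral_cst//; apply: le_Rintegral => //.
- exact: integrable_norm.
- by apply: measurable_bounded_integrable => //;
    [exact: surface_sphere_lty|exists c; split; rewrite ?num_real// => ? ? ? _;
     rewrite /= ger0_norm// ltW].
move=> u Su; rewrite normrM -[leRHS]mulr1 ler_pM//; last exact: sphere_coord_le.
apply: support_sphere_le => // x; have /andP[a0 _] := a01.
by move=> /(level_anti (lexx 0) a0); exact: hc.
Qed.

(** Level by level this is [steiner_translate]; the integral splits because the Steiner
points of the levels are integrable. *)
Lemma fsteiner_translate nu b :
  fsteiner (nu \oplus findic b) = fsteiner nu + b.
Proof.
apply/rowP => i; rewrite !mxE.
transitivity (\int[lebesgue_measure]_(a in `[0, 1])
    (steiner (level nu a) 0 i + b 0 i)).
  apply: eq_Rintegral => a; rewrite inE/= in_itv/= => a01.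
  by rewrite level_fadd_findic// steiner_translate ?mxE//; exact: level_body.
rewrite RintegralD//; first last.
- apply: measurable_bounded_integrable => //.
    by rewrite /= lebesgue_measure_itv/= lte01 oppr0 addr0 ltey.
  exists `|b 0 i|; split; first exact: num_real.
  by move=> M bM x _ /=; exact: ltW.
- exact: steiner_level_integrable.
congr (_ + _); rewrite Rintegral_cst//=.
by rewrite lebesgue_measure_itv/= lte01 oppr0 addr0 mulr1.
Qed.

End steiner_theory.

(** * The distance of a fuzzy set to a summand *)

Section d2_theory.
Context {R : realType} {d : nat} (d_gt0 : (0 < d)%N).
Notation sigma := (@surface R d).
Notation S := (@sphere R d).
Notation vol := (@unit_ball_volume R d).
Implicit Types (A H M nu mu : fuzzy R d).

Lemma surface_sphere_gt0 : 0 < fine (sigma S).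
Proof. by rewrite surface_sphere//= mulr_gt0 ?ltr0n ?unit_ball_volume_gt0. Qed.

Lemma sphere_mean_ge0 (f : 'rV[R]_d -> R) : (forall u, 0 <= f u) ->
  0 <= sphere_mean f.
Proof.
move=> f0; rewrite mulr_ge0//; first by rewrite invr_ge0 ltW// surface_sphere_gt0.
exact: Rintegral_ge0.
Qed.

Lemma d2_self nu : d2 nu nu = 0.
Proof.
rewrite /d2 /sphere_mean [X in Num.sqrt X](_ : _ = 0) ?sqrtr0//.
rewrite (eq_Rintegral _ (g := cst 0)) ?Rintegral_cst ?mul0r// => a _ /=.
rewrite (eq_Rintegral _ (g := cst 0)) ?Rintegral_cst ?mul0r ?mulr0//.
  exact: measurable_sphere.
by move=> u _; rewrite subrr normr0 expr0n.
Qed.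

(** On the cap where [u . a] exceeds [eta], the support function of a body that
contains [a] exceeds [eta]. *)
Lemma sphere_mean_support_sqr_bounds B a (eta c : R) : convex_body B ->
  0 <= eta -> (forall b, B b -> enorm b <= c) -> B a -> 
  eta ^+ 2 * fine (sigma (S `&` [set u | eta < dot u a])) / fine (sigma S) <=
  sphere_mean (fun u => `|support_fun B u| ^+ 2) <= c ^+ 2.
Proof.
move=> bB e0 hc Ba; have s0 := surface_sphere_gt0.
have := @Rintegral_bounds _ _ _ sigma S (S `&` [set u | eta < dot u a])
  (fun u => `|support_fun B u| ^+ 2) (eta ^+ 2) (c ^+ 2).
have mS := @measurable_sphere R d.
move=> /(_ mS (measurable_cap eta a) (@subIsetl _ _ _) (surface_sphere_lty d_gt0) (sqr_ge0 _)).
case/(_ _ _)/andP => [u Su|u [Su eu]|lo up].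
- rewrite sqr_ge0/= ler_sqr ?nnegrE ?normr_ge0//; first exact: support_sphere_le.
  by apply: le_trans (hc _ Ba); exact: enorm_ge0.
- rewrite ler_sqr ?nnegrE//; apply: le_trans (ler_norm _).
  by apply: le_trans (ltW eu) _; exact: dot_le_support.
by rewrite /sphere_mean [_^-1 * _]mulrC ler_pM2r ?invr_gt0// lo/= ler_pdivrMr.
Qed.

(** The difference of the support functions of [M] and [H] is the one of [A]. If some
[A_al] contained a nonzero point [a], so would all the levels below [al], and the
squared distance would be at least [al] times a positive bound coming from the
cap around [a]. *)
Lemma d2_summand_eq0 H A M : H \oplus A = M -> d2 M H = 0 -> M = H.
Proof.
move=> HA /eqP; rewrite /d2 sqrtr_eq0 => d0.
suff A0 : A = findic 0 by rewrite -HA A0 fadd_findic0.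
apply: fuzzy_ext_level => al /andP[al0 al1].
have al01 : 0 <= al <= 1 by rewrite ltW.
suff h a : level A al a -> a = 0.
  rewrite level_findic_fun//; apply/seteqP; split => [a /h //|_ ->].
  by have [a Aa] := level_neq0 A al01; rewrite -(h _ Aa).
move=> Aa; apply/eqP/contraT => a0; exfalso.
have [c c0 hc] := body_bounded (level_body A (a := 0) (andb_true_intro (conj (lexx 0) ler01))).
have na : 0 < enorm a by rewrite enorm_gt0.
pose eta := enorm a / 2; have eta0 : 0 < eta by rewrite divr_gt0.
pose k := eta ^+ 2 * fine (sigma (S `&` [set u | eta < dot u a])) / fine (sigma S).
have s0 := surface_sphere_gt0.
have cap0 : 0 < fine (sigma (S `&` [set u | eta < dot u a])).
  have := surface_cap_gt0 d_gt0 a0; rewrite -/eta => cap.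
  apply: fine_gt0; rewrite cap/=; apply: le_lt_trans (surface_sphere_lty d_gt0).
  apply: le_measure; last exact: subIsetl.
  - by apply: mem_set; exact: measurable_cap.
  - by apply: mem_set; exact: measurable_sphere.
have k0 : 0 < k by rewrite divr_gt0// mulr_gt0// exprn_gt0.
have E be : 0 <= be <= 1 ->
    sphere_mean (fun u => `|support_fun (level M be) u - support_fun (level H be) u| ^+ 2)
    = sphere_mean (fun u => `|support_fun (level A be) u| ^+ 2).
  move=> be01; rewrite /sphere_mean; congr (_ * _); apply: eq_Rintegral => u _.
  rewrite -HA level_fadd// support_mink; [|exact: level_body..].
  by rewrite addrC addKr.
have bnd be b : 0 <= be <= 1 -> level A be b -> enorm b <= c.
  by move=> /andP[b0 _] /(level_anti (lexx 0) b0); exact: hc.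
have := @Rintegral_bounds _ _ _ (@lebesgue_measure R) `[0, 1]%classic `[0, al]%classic
  (fun be => sphere_mean (fun u =>
    `|support_fun (level M be) u - support_fun (level H be) u| ^+ 2)) k (c ^+ 2).
case/(_ _ _ _ _ _ _ _)/andP => //.
- by move=> x /=; rewrite !in_itv/= => /andP[-> /le_trans ->].
- by rewrite /= lebesgue_measure_itv/= lte01 oppr0 addr0 ltey.
- exact: ltW.
- move=> be; rewrite /= in_itv/= => be01; rewrite sphere_mean_ge0/=; last first.
    by move=> u; exact: sqr_ge0.
  rewrite E//; have [b Ab] := level_neq0 A be01.
  have /andP[_] := sphere_mean_support_sqr_bounds (level_body A be01) (ltW eta0)
    (fun b => @bnd be b be01) Ab.
  exact.
- move=> be; rewrite /= in_itv/= => /andP[be0 be_al].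
  have be01 : 0 <= be <= 1 by rewrite be0 (le_trans be_al).
  rewrite E//.
  have /andP[+ _] := sphere_mean_support_sqr_bounds (level_body A be01) (ltW eta0)
    (fun b => @bnd be b be01) (level_anti be0 be_al Aa).
  exact.
move=> lo _; move: (le_trans lo d0).
rewrite leNgt => /negP; apply; rewrite mulr_gt0//.
by rewrite /= lebesgue_measure_itv/= lte_fin al0 oppr0 addr0.
Qed.

End d2_theory.

(** * Selections of random convex bodies *)

Section random.
Context {R : realType} {d : nat} {disp : measure_display}.
Context {Omega : measurableType disp} (P : probability Omega R).
Implicit Types (X : Omega -> fuzzy R d) (f g : Omega -> 'rV[R]_d) (u : 'rV[R]_d).

Definition hausdorff_continuous (F : set 'rV[R]_d -> R) : Prop :=
  forall A e, convex_body A -> 0 < e -> exists2 r, 0 < r &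
    forall B, convex_body B -> hausdorff_dist A B < r -> `|F A - F B| < e.

Lemma support_hausdorff_continuous u :
  hausdorff_continuous (fun A => support_fun A u).
Proof.
move=> A e bA e0; have u1 : 0 < enorm u + 1 by rewrite ltr_pwDr// enorm_ge0.
exists (e / (enorm u + 1)) => [|B bB AB]; first by rewrite divr_gt0.
apply: (le_lt_trans (support_hausdorff u bA bB AB)).
rewrite mulrCA gtr_pMr// ltr_pdivrMr// mul1r ltrDl//.
Qed.

Lemma body_proj_hausdorff_continuous p i :
  hausdorff_continuous (fun A => body_proj A p 0 i).
Proof.
move=> A e bA e0; have [r r0 h] := body_proj_hausdorff p bA e0.
exists r => // B bB AB; apply: le_lt_trans (h B bB AB).
by apply: le_trans (coord_le_enorm _ i); rewrite !mxE.
Qed.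

(** Superlevel sets of a continuous function are open for the Hausdorff metric. *)
Lemma frv_measurable X (a : R) (F : set 'rV[R]_d -> R) : frv X -> 0 < a <= 1 ->
  hausdorff_continuous F -> measurable_fun setT (fun w => F (level (X w) a)).
Proof.
move=> fX a01 cF.
apply: (measurability _ (RGenOInfty.measurableE R)) => _ [_ [c ->] <-].
rewrite setTI.
pose U := [set A : set 'rV[R]_d | convex_body A /\ c < F A].
rewrite (_ : _ @^-1` _ = [set w | U (level (X w) a)]); last first.
  apply/seteqP; split => w /=; rewrite in_itv/= andbT; last by case.
  by move=> cw; split => //; apply: level_body; case/andP: a01 => /ltW -> ->.
apply: fX => //; apply: sub_sigma_algebra.
split => [A []//|A [bA cA]].
have [|r r0 h] := cF A (F A - c) bA; first by rewrite subr_gt0.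
exists r => // B bB AB; split => //.
by have := h B bB AB; rewrite ltr_norml => /andP[_]; rewrite ltrD2l ltrN2.
Qed.

Lemma level_norm_le (nu : fuzzy R d) (a : R) x : 0 <= a <= 1 -> level nu a x ->
  enorm x <= sup [set enorm y | y in level nu 0].
Proof.
move=> /andP[a0 a1] nx.
have [|c _ hc] := @body_bounded R d (level nu 0); first by apply: level_body; rewrite lexx ler01.
apply: ub_le_sup; first by exists c => _ [y ny <-]; exact: hc.
by exists x => //; exact: (level_anti (lexx 0) a0).
Qed.

Lemma prob_lty : (P setT < +oo)%E. Proof. by rewrite probability_setT ltey. Qed.

Lemma ae_witness (Q : Omega -> Prop) : {ae P, forall w, Q w} -> exists w, Q w.
Proof.
have P0 : (0 < P setT)%E by rewrite probability_setT lte01.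
have PP : ProperFilter (almost_everywhere P).
  exact: ae_properfilter_algebraOfSetsType P0.
exact: filter_ex.
Qed.

Lemma L2_dominated_sqr X (h : Omega -> R) : L2_frv P X ->
  (forall w, `|h w| <= sup [set enorm y | y in level (X w) 0]) ->
  (\int[P]_w ((h w) ^+ 2)%:E < +oo)%E.
Proof.
move=> [_ X2] hX; apply: le_lt_trans X2.
apply: ge0_le_integral_nomeas => w _; rewrite lee_fin ?sqr_ge0//.
by rewrite -(real_normK (num_real (h w))) ler_sqr// nnegrE//;
  exact: le_trans (hX w).
Qed.

Lemma L2_dominated X (h : Omega -> R) : L2_frv P X -> measurable_fun setT h ->
  (forall w, `|h w| <= sup [set enorm y | y in level (X w) 0]) ->
  P.-integrable setT (EFin \o h).
Proof.
move=> X2 mh hX; apply: integrable_sqr => //; first exact: prob_lty.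
exact: L2_dominated_sqr hX.
Qed.

Lemma support_level_norm_le (nu : fuzzy R d) (a : R) u : 0 <= a <= 1 ->
  enorm u = 1 ->
  `|support_fun (level nu a) u| <= sup [set enorm y | y in level nu 0].
Proof.
move=> a01 u1; have := support_norm_le (level_body nu a01) u
  (fun x => @level_norm_le nu a x a01).
by rewrite u1 mul1r.
Qed.

Lemma support_integrable X (a : R) u : L2_frv P X -> 0 < a <= 1 -> enorm u = 1 ->
  P.-integrable setT (EFin \o (fun w => support_fun (level (X w) a) u)).
Proof.
move=> X2 a01 u1; have a01' : 0 <= a <= 1 by case/andP: a01 => /ltW -> ->.
apply: (L2_dominated X2); last by move=> w; exact: support_level_norm_le.
exact: (frv_measurable X2.1 a01 (support_hausdorff_continuous u)).
Qed.

Lemma expectE f i : expect P f 0 i = \int[P]_w f w 0 i.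
Proof. by rewrite mxE unlock. Qed.

Lemma dot_integrable u f : L1_vector P f ->
  P.-integrable setT (EFin \o (fun w => dot u (f w))).
Proof.
move=> fL; apply: integrable_sum_EFin => // i.
exact: (integrableZl measurableT (u 0 i) (fL i)).
Qed.

Lemma dot_expect u f : L1_vector P f ->
  dot u (expect P f) = \int[P]_w dot u (f w).
Proof.
move=> fL; rewrite /dot Rintegral_sum//; last first.
  by move=> i; exact: (integrableZl measurableT (u 0 i) (fL i)).
by apply: eq_bigr => i _; rewrite expectE RintegralZl//; exact: fL.
Qed.

Lemma L1_vectorB f g : L1_vector P f -> L1_vector P g ->
  L1_vector P (fun w => f w - g w).
Proof.
move=> fL gL i; rewrite (_ : (fun w => _) =
  (fun w => (f w 0 i)%:E) \- (fun w => (g w 0 i)%:E))%E; last first.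
  by apply/funext => w; rewrite !mxE EFinB.
exact: integrableB.
Qed.

Lemma expectB f g : L1_vector P f -> L1_vector P g ->
  expect P (fun w => f w - g w) = expect P f - expect P g.
Proof.
move=> fL gL; apply/rowP => i; rewrite [RHS]mxE [X in _ = _ + X]mxE !expectE.
rewrite -RintegralB//; [|exact: fL|exact: gL].
by apply: eq_Rintegral => w _; rewrite !mxE.
Qed.

Lemma integrable_cst_prob (c : R) : P.-integrable setT (EFin \o cst c).
Proof.
apply: (@measurable_bounded_integrable _ _ _ P (cst c)) => //.
  exact: prob_lty.
by exists `|c|; split; [exact: num_real|move=> M cM w _; exact: ltW].
Qed.

Lemma L1_vector_cst u : L1_vector P (fun=> u).
Proof. by move=> i; exact: integrable_cst_prob. Qed.

Lemma expect_cst u : expect P (fun=> u) = u.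
Proof.
apply/rowP => i; rewrite expectE Rintegral_cst//.
rewrite -[RHS]mulr1; congr (_ * _); exact: (congr1 fine (probability_setT P)).
Qed.

(** Jensen. The projection [p] of the expectation [z] on [B] separates: [v = z - p]
satisfies [v . b <= v . p] on [B], hence [v . z <= v . p] after integration, which
means [|v| ^ 2 <= 0]. *)
Lemma expect_in_body (B : set 'rV[R]_d) f : convex_body B -> L1_vector P f ->
  {ae P, forall w, B (f w)} -> B (expect P f).
Proof.
move=> bB fL fB; set z := expect P f; apply: in_body_of_proj => //.
set p := body_proj B z; pose v := z - p.
have iv : P.-integrable setT (EFin \o (fun w => dot v p - dot v (f w))).
  rewrite (_ : EFin \o _ = (fun=> (dot v p)%:E) \- (fun w => (dot v (f w))%:E))%E.
    apply: integrableB => //; last exact: dot_integrable.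
    exact: (dot_integrable v (L1_vector_cst p)).
  by apply/funext => w; rewrite /= EFinB.
have : 0 <= \int[P]_w (dot v p - dot v (f w)).
  apply: ae_ge0_Rintegral_ge0 => //; apply: filterS fB => w Bf.
  by have := body_proj_obtuse z bB Bf; rewrite -/p -/v dotBr; lra.
rewrite RintegralB//; [|exact: (dot_integrable v (L1_vector_cst p))
  |exact: dot_integrable].
have -> : \int[P]_w dot v p = dot v p.
  exact: etrans (esym (dot_expect v (L1_vector_cst p))) (congr1 (dot v) (expect_cst p)).
by rewrite -dot_expect// -/z dotBr; lra.
Qed.

Lemma body_proj_measurable X (a : R) p : frv X -> 0 < a <= 1 -> forall i,
  measurable_fun setT (fun w => body_proj (level (X w) a) p 0 i).
Proof.
by move=> fX a01 i; exact: (frv_measurable fX a01 (body_proj_hausdorff_continuous p i)).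
Qed.

Lemma body_proj_L1 X (a : R) p : L2_frv P X -> 0 < a <= 1 ->
  L1_vector P (fun w => body_proj (level (X w) a) p).
Proof.
move=> X2 a01 i; have a01' : 0 <= a <= 1 by case/andP: a01 => /ltW -> ->.
apply: (L2_dominated X2); first exact: (body_proj_measurable p X2.1 a01).
move=> w; apply: (le_trans (coord_le_enorm _ i)).
by apply: (level_norm_le a01'); apply: body_proj_in; exact: level_body.
Qed.

(** A bound of the squared norm on a body which, being built from support functions,
is measurable along a random convex body. *)
Definition axes_sqr (A : set 'rV[R]_d) : R := \sum_(i < d)
  (support_fun A (delta_mx 0 i) ^+ 2 + support_fun A (- delta_mx 0 i) ^+ 2).

Lemma axes_sqr_ge (A : set 'rV[R]_d) x : convex_body A -> A x ->
  dot x x <= axes_sqr A.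
Proof.
move=> bA Ax; apply: ler_sum => i _.
have := dot_le_support bA (delta_mx 0 i) Ax.
have := dot_le_support bA (- delta_mx 0 i) Ax.
rewrite dotNl dotC dot_delta; set s := support_fun _ _; set t := support_fun _ _.
by case: (leP 0 (x 0 i)) => h h1 h2; nra.
Qed.

Lemma axes_sqr_integrable X (a : R) : L2_frv P X -> 0 < a <= 1 ->
  P.-integrable setT (EFin \o (fun w => axes_sqr (level (X w) a))).
Proof.
move=> X2 a01; have a01' : 0 <= a <= 1 by case/andP: a01 => /ltW -> ->.
have sq u : enorm u = 1 ->
    P.-integrable setT (fun w => (support_fun (level (X w) a) u ^+ 2)%:E).
  move=> u1; apply/integrableP; split.
    apply/measurable_EFinP; apply: measurable_funX.
    exact: (frv_measurable X2.1 a01 (support_hausdorff_continuous u)).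
  under eq_integral do rewrite gee0_abs ?lee_fin ?sqr_ge0//.
  by apply: (L2_dominated_sqr X2) => w; exact: support_level_norm_le.
apply: integrable_sum_EFin => // i.
rewrite (_ : EFin \o _ =
    (fun w => (support_fun (level (X w) a) (delta_mx 0 i) ^+ 2)%:E) \+
    (fun w => (support_fun (level (X w) a) (- delta_mx 0 i) ^+ 2)%:E))%E; last first.
  by apply/funext => w; rewrite /= EFinD.
by apply: integrableD => //; apply: sq; rewrite ?enormN enorm_delta.
Qed.

(** The opposite inequality is immediate, as no selection exceeds the support
function. Here the projections of the far away points [k u] form measurable
selections that almost attain the support function, up to [Q / (2 k)]. *)
Lemma support_aumann_ge X (EX : fuzzy R d) (a : R) u : L2_frv P X ->
  aumann_expectation P X EX -> 0 < a <= 1 -> enorm u = 1 ->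
  \int[P]_w support_fun (level (X w) a) u <= support_fun (level EX a) u.
Proof.
move=> X2 EXP a01 u1; have a01' : 0 <= a <= 1 by case/andP: a01 => /ltW -> ->.
pose Q := \int[P]_w axes_sqr (level (X w) a).
have Q0 : 0 <= Q.
  apply: Rintegral_ge0 => w _; apply: sumr_ge0 => i _.
  by rewrite addr_ge0 ?sqr_ge0.
have key k : 0 < k -> \int[P]_w support_fun (level (X w) a) u
    <= support_fun (level EX a) u + (2 * k)^-1 * Q.
  move=> k0; pose f w := body_proj (level (X w) a) (k *: u).
  have fL : L1_vector P f by exact: body_proj_L1.
  have iQ := axes_sqr_integrable X2 a01.
  have ikQ : P.-integrable setT
      (EFin \o (fun w => (2 * k)^-1 * axes_sqr (level (X w) a))).
    exact: (integrableZl measurableT (2 * k)^-1 iQ).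
  have ifQ : P.-integrable setT (EFin \o (fun w =>
      dot u (f w) + (2 * k)^-1 * axes_sqr (level (X w) a))).
    rewrite (_ : EFin \o _ = (fun w => (dot u (f w))%:E) \+
      (fun w => ((2 * k)^-1 * axes_sqr (level (X w) a))%:E))%E.
      by apply: integrableD => //; exact: dot_integrable.
    by apply/funext => w; rewrite /= EFinD.
  apply: (@le_trans _ _ (dot u (expect P f) + (2 * k)^-1 * Q)).
    rewrite dot_expect// /Q -RintegralZl// -RintegralD//; last exact: dot_integrable.
    apply: le_Rintegral => //; first exact: support_integrable.
    move=> w _; rewrite [_^-1 * _]mulrC.
    by apply: support_body_proj_gap => //; [exact: level_body|
      move=> x; exact: axes_sqr_ge (level_body (X w) a01')].
  rewrite lerD2r; apply: dot_le_support; first exact: level_body.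
  rewrite EXP//; exists f => //; split => //.
  by apply: aeW => w; apply: body_proj_in; exact: level_body.
move: key; set s := support_fun (level EX a) u; set J := Rintegral _ _ _ => key.
rewrite leNgt; apply/negP => sJ; have g0 : 0 < J - s by rewrite subr_gt0.
have Q1 : 0 < Q + 1 by rewrite ltr_pwDr.
(* With this [k] the error is less than half of the supposed gap [J - s]. *)
have := key ((Q + 1) / (J - s)); rewrite divr_gt0// => /(_ isT).
have -> : (2 * ((Q + 1) / (J - s)))^-1 * Q = (J - s) * (Q / (2 * (Q + 1))).
  by field; rewrite ?gt_eqF.
rewrite -lerBlDl leNgt => /negP; apply.
by rewrite gtr_pMr// ltr_pdivrMr ?mulr_gt0//; lra.
Qed.

End random.

(** * Translations and the Aumann expectation *)

Section characterization.
Context {R : realType} {d : nat} (d_gt0 : (0 < d)%N).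
Context {disp : measure_display} {Omega : measurableType disp}.
Variable P : probability Omega R.
Implicit Types (X : Omega -> fuzzy R d) (H M A nu EX : fuzzy R d).

Definition width (A : set 'rV[R]_d) (i : 'I_d) : R :=
  support_fun A (delta_mx 0 i) + support_fun A (- delta_mx 0 i).

Lemma width_mink (A B : set 'rV[R]_d) i : convex_body A -> convex_body B ->
  width (mink A B) i = width A i + width B i.
Proof. by move=> bA bB; rewrite /width !support_mink//; ring. Qed.

Lemma width_set1 (b : 'rV[R]_d) i : width [set b] i = 0.
Proof. by rewrite /width !support_set1 dotNl subrr. Qed.

Lemma coord_dist_le_width (A : set 'rV[R]_d) i x y : convex_body A ->
  A x -> A y -> x 0 i - y 0 i <= width A i.
Proof.
move=> bA Ax Ay.
have := dot_le_support bA (delta_mx 0 i) Ax.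
have := dot_le_support bA (- delta_mx 0 i) Ay.
by rewrite dotNl !(dotC (delta_mx 0 i)) !dot_delta /width; lra.
Qed.

(** The levels [1 / (n + 1)] are cofinal at [0], and a body whose width vanishes along
every axis is a point. *)
Lemma width_eq0_findic A : (forall n i, width (level A (n.+1%:R^-1)) i = 0) ->
  exists a, A = findic a.
Proof.
have n01 n : 0 <= (n.+1%:R^-1 : R) <= 1 by rewrite invr_ge0 ler0n invf_le1 ?ler1n.
move=> A0; have one x y n : level A n.+1%:R^-1 x -> level A n.+1%:R^-1 y -> x = y.
  move=> Ax Ay; apply/rowP => i; apply/eqP; rewrite eq_le.
  have bA := level_body A (n01 n).
  have := coord_dist_le_width i bA Ax Ay; have := coord_dist_le_width i bA Ay Ax.
  by rewrite A0 !subr_le0 => -> ->.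
have [a Aa] := level_neq0 A (andb_true_intro (conj (@ler01 R) (lexx 1))).
exists a; apply: fuzzy_ext_level => al /andP[al0 al1].
have al01 : 0 <= al <= 1 by rewrite ltW.
pose n := Num.truncn al^-1.
have nal : n.+1%:R^-1 <= al.
  by rewrite -[leRHS]invrK lef_pV2 ?posrE ?invr_gt0// ltW// truncnS_gt.
have n0 : 0 <= (n.+1%:R^-1 : R) by case/andP: (n01 n).
rewrite level_findic_fun//; apply/seteqP; split => [x Ax|_ ->].
  apply: (@one x a n).
    exact: level_anti n0 nal _ Ax.
  by apply: (level_anti n0 _ Aa); case/andP: (n01 n).
by apply: (level_anti (ltW al0) al1 Aa).
Qed.

(** The width is invariant under translation and additive. By [support_aumann_ge] the
mean width of [X_al] is at most the width of [EX_al], that is of [H_al], although [H]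
is a summand of [X] up to translation. Hence the other summand has no width: it
is a point, and comparing the Steiner points identifies it. *)
Lemma translation_of_aumann X EX H e : L2_frv P X -> aumann_expectation P X EX ->
  Theta P (recenter X) H -> EX = H \oplus findic e -> translation P X.
Proof.
move=> X2 EXP TH EXH.
have n01 n : 0 < (n.+1%:R^-1 : R) <= 1 by rewrite invr_gt0 ltr0n invf_le1 ?ler1n.
have n01' n : 0 <= (n.+1%:R^-1 : R) <= 1 by case/andP: (n01 n) => /ltW -> ->.
have wX w A n i : H \oplus A = recenter X w ->
    width (level (X w) n.+1%:R^-1) i =
    width (level H n.+1%:R^-1) i + width (level A n.+1%:R^-1) i.
  move=> HA; have : level (recenter X w) n.+1%:R^-1 = level (H \oplus A) n.+1%:R^-1.
    by rewrite HA.
  rewrite level_fadd_findic// level_fadd// => /(congr1 (width ^~ i)).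
  rewrite !width_mink//; try exact: level_body; last exact: convex_body_set1.
  by rewrite width_set1 addr0.
have w0 A n i : 0 <= width (level A n.+1%:R^-1) i.
  have [x Ax] := level_neq0 A (n01' n).
  by have := coord_dist_le_width i (level_body A (n01' n)) Ax Ax; rewrite subrr.
have supp_int n s : enorm s = 1 -> P.-integrable setT
    (EFin \o (fun w => support_fun (level (X w) n.+1%:R^-1) s)).
  by move=> s1; exact: support_integrable.
have width_ae n i : {ae P, forall w,
    width (level (X w) n.+1%:R^-1) i - width (level H n.+1%:R^-1) i = 0}.
  have e1 : enorm (delta_mx 0 i : 'rV[R]_d) = 1 by exact: enorm_delta.
  have e2 : enorm (- delta_mx 0 i : 'rV[R]_d) = 1 by rewrite enormN.
  have iw : P.-integrable setT (EFin \o (fun w => width (level (X w) n.+1%:R^-1) i)).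
    rewrite (_ : EFin \o _ =
      (fun w => (support_fun (level (X w) n.+1%:R^-1) (delta_mx 0 i))%:E) \+
      (fun w => (support_fun (level (X w) n.+1%:R^-1) (- delta_mx 0 i))%:E))%E.
      by apply: integrableD => //; exact: supp_int.
    by apply/funext => w; rewrite /= EFinD.
  apply: ae_ge0_Rintegral_eq0.
  - rewrite (_ : EFin \o _ = (fun w => (width (level (X w) n.+1%:R^-1) i)%:E) \-
      (fun w => (width (level H n.+1%:R^-1) i)%:E))%E.
      by apply: integrableB => //; exact: integrable_cst_prob.
    by apply/funext => w; rewrite /= EFinB.
  - apply: filterS TH => w [_ [A HA]].
    by rewrite (wX _ _ _ _ HA) addrC addKr.
  rewrite RintegralB//; last exact: integrable_cst_prob.
  rewrite Rintegral_cst//.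
  have -> : fine (P setT) = 1 by exact: (congr1 fine (probability_setT P)).
  rewrite mulr1 subr_le0 {1}/width RintegralD//; try exact: supp_int.
  apply: (@le_trans _ _ (width (level EX n.+1%:R^-1) i)).
    by rewrite lerD//; exact: support_aumann_ge.
  rewrite EXH level_fadd_findic// width_mink//; last exact: convex_body_set1.
    by rewrite width_set1 addr0.
  exact: level_body.
have width_all : {ae P, forall w, forall n, forall i,
    width (level (X w) n.+1%:R^-1) i - width (level H n.+1%:R^-1) i = 0}.
  by apply: ae_foralln => n; apply: filter_forall => i; exact: width_ae.
have [w [H0 _]] := ae_witness TH.
exists H; split => //.
move: TH width_all; apply: filterS2 => w' [_ [A HA]] W.
have [a Aa] : exists a, A = findic a.
  apply: width_eq0_findic => n i; have := W n i.
  by rewrite (wX _ _ _ _ HA) addrC addKr.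
have XH : X w' = H \oplus findic (a + fsteiner (X w')).
  by rewrite -findicD -fadd_findicA -Aa HA fadd_findicKN.
have : fsteiner (X w') = a + fsteiner (X w').
  by rewrite {1}XH fsteiner_translate// H0 add0r.
move=> E; have a0 : a = 0 by apply: (addIr (fsteiner (X w'))); rewrite add0r.
by rewrite {1}XH a0 add0r.
Qed.

Hypothesis P_complete : measure_is_complete P.

(** Since [X] is a moving copy of [M], its translation vector can be read off
from the support function of [X_1] along the axes, which is measurable and dominated.
Completeness of the probability carries measurability over the null set. *)
Lemma translation_steiner_L1 X M (t : Omega -> 'rV[R]_d) : L2_frv P X ->
  {ae P, forall w, X w = M \oplus findic (t w)} -> L1_vector P t.
Proof.
move=> X2 XM i; have I1 : 0 < (1 : R) <= 1 by rewrite ltr01 lexx.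
have I1' : 0 <= (1 : R) <= 1 by rewrite ler01 lexx.
pose h w := support_fun (level (X w) 1) (delta_mx 0 i)
  - support_fun (level M 1) (delta_mx 0 i).
have ih : P.-integrable setT (EFin \o h).
  rewrite (_ : EFin \o _ =
    (fun w => (support_fun (level (X w) 1) (delta_mx 0 i))%:E) \-
    (fun=> (support_fun (level M 1) (delta_mx 0 i))%:E))%E.
    apply: integrableB => //; first by apply: support_integrable; rewrite ?enorm_delta.
    exact: (integrable_cst_prob P (support_fun (level M 1) (delta_mx 0 i))).
  by apply/funext => w; rewrite /= EFinB.
have ht : {ae P, forall w, h w = t w 0 i}.
  apply: filterS XM => w XMw.
  rewrite /h XMw level_fadd_findic// support_mink//; last 2 first.
  - exact: level_body.
  - exact: convex_body_set1.
  by rewrite support_set1 dotC dot_delta addrC addKr.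
have mh : measurable_fun setT h by apply/measurable_EFinP; exact: measurable_int ih.
have mt := ae_eq_measurable P_complete mh ht.
apply/integrableP; split; first exact/measurable_EFinP.
rewrite -(@ae_eq_integral_complete _ _ _ P P_complete (fun w => `|(h w)%:E|)%E).
- by case/integrableP: ih.
- by apply: measurableT_comp => //; exact/measurable_EFinP.
- by apply: filterS ht => w /= ->.
Qed.

(** Subtracting [t] turns the selections of [X_a] into those of the fixed body [M_a],
whose expectations fill [M_a]: by Jensen they stay inside, and the constant
selections reach every point. *)
Lemma aumann_of_translation X EX M t : L2_frv P X -> aumann_expectation P X EX ->
  {ae P, forall w, X w = M \oplus findic (t w)} ->
  EX = M \oplus findic (expect P t).
Proof.
move=> X2 EXP XM; have tL := translation_steiner_L1 X2 XM.
apply: fuzzy_ext_level => a /andP[/ltW a0 a1].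
have a01 : 0 <= a <= 1 by rewrite a0.
rewrite EXP// level_fadd_findic//; apply/seteqP; split => z.
  move=> [f [fL fX] <-]; apply/in_mink_set1; rewrite -expectB//.
  apply: expect_in_body; [exact: level_body|exact: L1_vectorB|].
  move: fX XM; apply: filterS2 => w fw Xw.
  by move: fw; rewrite Xw level_fadd_findic// => /in_mink_set1.
move=> /in_mink_set1 Mz; set c := z - expect P t in Mz.
have cL := L1_vector_cst P c.
have tNL : L1_vector P (fun w => 0 - t w) by apply: L1_vectorB => //; exact: L1_vector_cst.
exists (fun w => c - (0 - t w)).
  split; first exact: L1_vectorB.
  apply: filterS XM => w ->; rewrite level_fadd_findic//.
  by apply/in_mink_set1; rewrite sub0r opprK addrK.
rewrite (expectB cL tNL) (expectB (L1_vector_cst P 0) tL) !expect_cst.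
by rewrite sub0r opprK subrK.
Qed.

(** The recentered variable is constantly [M], and [M] is a summand of itself, so the
minimal cost is [0]; a summand of [M] at distance [0] is [M]. *)
Lemma translation_projection X H M : Hperp P (recenter X) H -> fsteiner M = 0 ->
  {ae P, forall w, X w = M \oplus findic (fsteiner (X w))} -> M = H.
Proof.
move=> [TH minH] M0 XM.
have ZM : {ae P, forall w, recenter X w = M}.
  by apply: filterS XM => w Xw; rewrite /recenter {1}Xw fadd_findicK.
have TM : Theta P (recenter X) M.
  apply: filterS ZM => w ->; split => //.
  by exists (findic 0); rewrite fadd_findic0.
have cost B : mean_square_d2 P (recenter X) B = (d2 M B ^+ 2)%:E.
  rewrite /mean_square_d2 -(@ae_eq_integral_complete _ _ _ P P_complete
    (cst (d2 M B ^+ 2)%:E)); last by apply: filterS ZM => w ->.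
    rewrite integral_cst// -[RHS]mule1; congr (_ * _)%E.
    exact: probability_setT.
  exact: measurable_cst.
have [w [[_ [A HA]] Zw]] := ae_witness (filterI TH ZM).
apply: (@d2_summand_eq0 R d d_gt0 H A); first by rewrite HA.
have := minH M TM; rewrite !cost d2_self// lee_fin expr0n/= => d0.
by apply/eqP; rewrite -sqrf_eq0 eq_le d0 sqr_ge0.
Qed.

End characterization.

Theorem theorem8 (R : realType) (d : nat) (d_gt0 : (0 < d)%N)
    (disp : measure_display) (Omega : measurableType disp)
    (P : probability Omega R) (P_complete : measure_is_complete P)
    (X : Omega -> fuzzy R d) (X_L2 : L2_frv P X)
    (EX : fuzzy R d) (EX_def : aumann_expectation P X EX)
    (H : fuzzy R d) (H_def : Hperp P (recenter X) H) :
  translation P X <->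
  EX = H \oplus findic (expect P (fun w => fsteiner (X w))).
Proof.
split=> [[M [M0 XM]]|EXH].
  by rewrite -(translation_projection d_gt0 P_complete H_def M0 XM);
    exact: (aumann_of_translation P_complete X_L2 EX_def XM).
exact: (translation_of_aumann d_gt0 X_L2 EX_def H_def.1 EXH).
Qed.
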